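(* Let $\Omega\subset\mathbb{R}$ be a finite union of closed bounded intervals, let $w>0$ be a positive continuous weight function on $\Omega$, and let $0<\alpha<1$, $1\leq p\leq\infty$ and $m\geq 2$ be an integer. Then $W^{m,p}(w,\Omega)$ is dense in $W^{\alpha,p}(w,\Omega)$ with respect to the topology of $\mathrm{L}^p(w,\Omega)$.
   Context: $\mathbb{C}^+=\{z\in\mathbb{C}:\Im z>0\}$. A Herglotz function is an analytic $h\colon\mathbb{C}^+\to\mathbb{C}$ with $\Im h\geq 0$; a quasi-Herglotz function is an analytic $q\colon\mathbb{C}^+\to\mathbb{C}$ with $q=h_1-h_2$ for Herglotz functions $h_1,h_2$. $\mathrm{L}^p(w,\Omega)$ is the Banach space with norm $\|f\|=(\int_\Omega w|f|^p\,\mathrm{d}x)^{1/p}$ for $p<\infty$, and the essential supremum of $w|f|$ for $p=\infty$. $C^{0,\alpha}(\Omega)$ is the space of complex-valued Hölder continuous functions with exponent $\alpha$ on $\Omega$. $W^{\alpha,p}(w,\Omega)\subset\mathrm{L}^p(w,\Omega)$ is the subspace of all complex-valued $q\in C^{0,\alpha}(\Omega)$ such that there exists a quasi-Herglotz function which has a Hölder continuous (exponent $\alpha$) extension to $\mathbb{C}^+\cup\overline{\mathcal{O}}$ for some open neighborhood $\mathcal{O}$ of $\Omega$, coinciding with $q$ on $\Omega$; it carries the topology of $\mathrm{L}^p(w,\Omega)$. $W^{m,p}(w,\Omega)\subset W^{\alpha,p}(w,\Omega)$ is the subspace of those functions for which this quasi-Herglotz function can be written as $q(z)=a+bz+\int_\mathbb{R}\left(\frac{1}{\xi-z}-\frac{\xi}{1+\xi^2}\right)\mathrm{d}\beta(\xi)$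 ($a,b\in\mathbb{R}$) with a signed Borel measure $\beta$ that is absolutely continuous with density $\beta'$ equal to a finite uniform B-spline expansion of order $m$, i.e. a finite linear combination of B-splines of order $m$ (compactly supported, piecewise polynomial of degree $m-1$, each defined by $m+1$ break-points) with equidistant break-points. *)

(* Defs.v *)
From HB Require Import structures.
From mathcomp Require Import all_boot all_order all_algebra.
From mathcomp Require Import all_classical all_reals all_analysis.
From mathcomp Require Import complex.
Import Order.TTheory GRing.Theory Num.Theory.
Import numFieldTopology.Exports numFieldNormedType.Exports.

Set Implicit Arguments.
Unset Strict Implicit.
Unset Printing Implicit Defensive.

Local Open Scope classical_set_scope.
Local Open Scope ring_scope.
Local Open Scope complex_scope.

Section Defs.
Variable R : realType.

(* The complex plane, with the topology induced by its modulus. *)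
Definition Cplx : numClosedFieldType := R[i].

Definition cabs (z : Cplx) : R := complex.Re `|z|.

Definition UHP : set Cplx := [set z | 0 < complex.Im z].

Definition realC (x : R) : Cplx := x%:C.

Definition analytic_on (D : set Cplx) (f : Cplx -> Cplx) : Prop :=
  forall z, D z -> exists l : Cplx,
    (fun h : Cplx => (f (z + h) - f z) / h) @ (0 : Cplx)^' --> l.

Definition herglotz (h : Cplx -> Cplx) : Prop :=
  analytic_on UHP h /\ forall z, UHP z -> 0 <= complex.Im (h z).

Definition quasi_herglotz (q : Cplx -> Cplx) : Prop :=
  analytic_on UHP q /\
  exists h1 h2, herglotz h1 /\ herglotz h2 /\
    forall z, UHP z -> q z = h1 z - h2 z.

Definition fin_union_closed_intervals (Om : set R) : Prop :=
  exists s : seq (R * R),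
    Om = [set x | has (fun ab : R * R => (ab.1 <= x <= ab.2)) s].

Definition holder_on (A : set R) (al : R) (f : R -> Cplx) : Prop :=
  exists c : R, forall x y, A x -> A y ->
    cabs (f x - f y) <= c * (powR `|x - y| al).

Definition holder_loc_on (S : set Cplx) (al : R) (F : Cplx -> Cplx) : Prop :=
  forall r : R, 0 < r -> exists c : R, forall z u, S z -> S u ->
    cabs z <= r -> cabs u <= r ->
    cabs (F z - F u) <= c * (powR (cabs (z - u)) al).

Definition UHP_cl (O : set R) : set Cplx :=
  UHP `|` [set z | complex.Im z = 0 /\ closure O (complex.Re z)].

Definition qh_holder_extension (Om : set R) (al : R) (q : R -> Cplx)
    (Q : Cplx -> Cplx) : Prop :=
  quasi_herglotz Q /\
  exists O : set R, open O /\ Om `<=` O /\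
    holder_loc_on (UHP_cl O) al Q /\
    forall x, Om x -> Q (realC x) = q x.

(* W^{al,p}(w,Om) (as a set; its topology is that of L^p(w,Om)) *)
Definition W_alpha (Om : set R) (al : R) (q : R -> Cplx) : Prop :=
  holder_on Om al q /\ exists Q, qh_holder_extension Om al q Q.

Definition cardinal_bspline (m : nat) (x : R) : R :=
  (m.-1)`!%:R^-1 *
  \sum_(j < m.+1) (-1) ^+ j * 'C(m, j)%:R * (Num.max (x - j%:R) 0) ^+ m.-1.

Definition uniform_bspline_expansion (m : nat) (f : R -> R) : Prop :=
  exists (x0 h : R) (N : nat) (c : nat -> R), 0 < h /\
    forall x, f x = \sum_(k < N) c k * cardinal_bspline m ((x - x0) / h - k%:R).

Definition cintegral (f : R -> Cplx) : Cplx :=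
  (Rintegral lebesgue_measure setT (fun x => complex.Re (f x)))%:C +
  'i * (Rintegral lebesgue_measure setT (fun x => complex.Im (f x)))%:C.

Definition nevanlinna_repr (a b : R) (beta' : R -> R) (Q : Cplx -> Cplx) : Prop :=
  forall z, UHP z ->
    Q z = a%:C + b%:C * z +
      cintegral (fun xi => ((realC xi - z)^-1 - (xi / (1 + xi ^+ 2))%:C)
                           * (beta' xi)%:C).

Definition W_m (Om : set R) (al : R) (m : nat) (q : R -> Cplx) : Prop :=
  holder_on Om al q /\
  exists Q, qh_holder_extension Om al q Q /\
    exists (a b : R) (beta' : R -> R),
      uniform_bspline_expansion m beta' /\ nevanlinna_repr a b beta' Q.

Definition Lp_w_norm (Om : set R) (w : R -> R) (p : \bar R) (f : R -> Cplx)
  : \bar R :=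
  match p with
  | EFin p' => poweR (\int[lebesgue_measure]_(x in Om)
                        (w x * powR (cabs (f x)) p')%:E) p'^-1
  | _ => ereal_inf [set y : \bar R |
            {ae lebesgue_measure, forall x, Om x -> ((w x * cabs (f x))%:E <= y)%E}]
  end.

End Defs.

(* Main.v *)
(* W^{m,p} is dense, for the uniform norm, in all Hoelder continuous functions
   on Om. Let F(z) = int B(s) / (s - z) ds be the Cauchy transform of the
   cardinal B-spline B; on the real axis Im F = pi B, and F is real to the left
   of the support of B. The imaginary part of q is approximated by a combination
   of B-splines on a fine grid; by linearity it remains to approximate a real
   function on Om without changing the imaginary part. This is done with the
   B-splines of the same grid lying to the right of Om: expanding
   F(t - k) in powers of 1/k, the coefficient of 1/k^(j+1) is a polynomial in t
   of exact degree j, so letting k tend to infinity the uniformly closed span of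
   the functions F(t - k), k >= K0, contains all polynomials, hence by
   Weierstrass all continuous functions.

   Membership in W^{m,p} uses the closed form
     F(z) = P(z) - sum_j c_j (z - j)^(m-1) log (z - j)
   with P a real polynomial and c_j = (-1)^j C(m,j) / (m-1)!, which is Hoelder
   continuous of any exponent < 1 on bounded parts of the closed half-plane,
   because z log z is. *)
Require Import Defs.
From HB Require Import structures.
From mathcomp Require Import all_boot all_order all_algebra.
From mathcomp Require Import all_classical all_reals all_analysis.
From mathcomp Require Import complex.
From mathcomp Require Import measurable_realfun.
From mathcomp Require Import ring lra zify.
Import Order.TTheory GRing.Theory Num.Theory.
Import numFieldTopology.Exports numFieldNormedType.Exports.
Local Open Scope classical_set_scope.
Local Open Scope ring_scope.
Set Implicit Arguments.
Unset Strict Implicit.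
Unset Printing Implicit Defensive.

(** * Modulus, real and imaginary parts *)

Section Modulus.
Variable R : realType.
Local Open Scope complex_scope.
Implicit Types z u : Cplx R.

(** Uniform approximation of Im q says nothing about the real part: on the axis the real part of a
    Cauchy transform is, up to normalisation, the Hilbert transform of its density, and that
    operator is unbounded in the uniform norm. So the real part that the first approximant happens
    to have is accepted, and its error becomes a fresh target. This error is again Hölder
    continuous, because the boundary values of the approximant are. The correction is restricted
    twice: its density must vanish on Om, and it must live on the mesh already chosen, since one
    uniform expansion has a single spacing. Only distant translates with the same step remain, so
    the approximation cannot come from refinement; it comes from the asymptotics of the translates
    at infinity, where nearly proportional functions are combined with large coefficients. The
    successive polynomials can be solved for powers of t because the B-spline has integral 1, which
    is their common leading coefficient. All estimates are uniform on Om; boundedness of Om and of w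
    then covers every p at once. *)

Lemma cabsE z : cabs z = Num.sqrt (complex.Re z ^+ 2 + complex.Im z ^+ 2).
Proof. by rewrite /cabs normc_def. Qed.

Lemma normE z : `|z| = (cabs z)%:C.
Proof. by rewrite cabsE normc_def. Qed.

Lemma cabs_ge0 z : 0 <= cabs z.
Proof. by rewrite cabsE sqrtr_ge0. Qed.

Lemma cabs0 : cabs (0 : Cplx R) = 0.
Proof. by rewrite /cabs normr0. Qed.

Lemma cabsM z u : cabs (z * u) = cabs z * cabs u.
Proof. by rewrite /cabs normrM !normE /= mul0r subr0. Qed.

Lemma cabs1 : cabs (1 : Cplx R) = 1.
Proof. by rewrite /cabs normr1. Qed.

Lemma cabsX z n : cabs (z ^+ n) = cabs z ^+ n.
Proof. by elim: n => [|n IH]; rewrite ?expr0 ?cabs1// !exprS cabsM IH. Qed.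

Lemma cabsD z u : cabs (z + u) <= cabs z + cabs u.
Proof. by rewrite -lecR rmorphD /= -!normE ler_normD. Qed.

Lemma cabsN z : cabs (- z) = cabs z.
Proof. by rewrite /cabs normrN. Qed.

Lemma cabsC z u : cabs (z - u) = cabs (u - z).
Proof. by rewrite -cabsN opprB. Qed.

Lemma cabsV z : cabs z^-1 = (cabs z)^-1.
Proof.
have [->|z0] := eqVneq z 0; first by rewrite invr0 cabs0 invr0.
have z1 : cabs z * cabs z^-1 = 1 by rewrite -cabsM divff// cabs1.
have cz : cabs z != 0 by apply: contra_eq_neq z1 => ->; rewrite mul0r eq_sym oner_eq0.
by apply: (mulfI cz); rewrite z1 divff.
Qed.

Lemma cabs_eq0 z : (cabs z == 0) = (z == 0).
Proof.
apply/eqP/eqP => [z0|->]; last exact: cabs0.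
by apply/normr0_eq0; rewrite normE z0.
Qed.

Lemma cabs_gt0 z : (0 < cabs z) = (z != 0).
Proof. by rewrite lt_def cabs_ge0 cabs_eq0 andbT. Qed.

Lemma cabs_real (x : R) : cabs (x%:C : Cplx R) = `|x|.
Proof. by rewrite cabsE /= expr0n addr0 sqrtr_sqr. Qed.

Lemma sqr_cabs z : cabs z ^+ 2 = complex.Re z ^+ 2 + complex.Im z ^+ 2.
Proof. by rewrite cabsE sqr_sqrtr// addr_ge0// sqr_ge0. Qed.

Lemma Re_le_cabs z : `|complex.Re z| <= cabs z.
Proof. by rewrite cabsE -sqrtr_sqr ler_wsqrtr// lerDl sqr_ge0. Qed.

Lemma Im_le_cabs z : `|complex.Im z| <= cabs z.
Proof. by rewrite cabsE -sqrtr_sqr ler_wsqrtr// lerDr sqr_ge0. Qed.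

Lemma cabs_le z : cabs z <= `|complex.Re z| + `|complex.Im z|.
Proof.
rewrite {1}[z]complexE (le_trans (cabsD _ _))// cabs_real cabsM cabs_real.
by rewrite cabsE /= expr0n expr1n add0r sqrtr1 mul1r.
Qed.

Lemma ReD z u : complex.Re (z + u) = complex.Re z + complex.Re u.
Proof. by case: z; case: u. Qed.

Lemma ImD z u : complex.Im (z + u) = complex.Im z + complex.Im u.
Proof. by case: z; case: u. Qed.

Lemma ReN z : complex.Re (- z) = - complex.Re z.
Proof. by case: z. Qed.

Lemma ImN z : complex.Im (- z) = - complex.Im z.
Proof. by case: z. Qed.

Lemma ReM z u : complex.Re (z * u) =
  complex.Re z * complex.Re u - complex.Im z * complex.Im u.
Proof. by case: z; case: u. Qed.

Lemma ImM z u : complex.Im (z * u) =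
  complex.Re z * complex.Im u + complex.Im z * complex.Re u.
Proof. by case: z => a b; case: u => c d /=; ring. Qed.

Lemma Re_sum (I : Type) (s : seq I) (P : pred I) (f : I -> Cplx R) :
  complex.Re (\sum_(i <- s | P i) f i) = \sum_(i <- s | P i) complex.Re (f i).
Proof. by elim/big_ind2: _ => // z x u y <- <-; rewrite ReD. Qed.

Lemma Im_sum (I : Type) (s : seq I) (P : pred I) (f : I -> Cplx R) :
  complex.Im (\sum_(i <- s | P i) f i) = \sum_(i <- s | P i) complex.Im (f i).
Proof. by elim/big_ind2: _ => // z x u y <- <-; rewrite ImD. Qed.

End Modulus.

(** * Hölder functions on bounded parts of the closed half-plane *)

Section HolderCalculus.
Variables (R : realType) (al : R).
Hypothesis al01 : 0 < al < 1.
Local Open Scope complex_scope.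

Definition UHPc : set (Cplx R) := [set z | 0 <= complex.Im z].

Let al0 : 0 < al. Proof. by case/andP: al01. Qed.

(** Write [t] as [t^(1-al)] times [t^al] and enlarge the first factor: a Lipschitz bound on a
    bounded set becomes a Hölder bound. *)
Lemma powR_split (t r : R) : 0 <= t <= r -> t <= powR r (1 - al) * powR t al.
Proof.
case/andP=> t0 tr; have [->|tn0] := eqVneq t 0.
  by rewrite mulr_ge0// powR_ge0.
rewrite -{1}[t]powRr1// -{1}(subrK al 1) powRD; last by apply/implyP.
rewrite ler_wpM2r ?powR_ge0// ge0_ler_powR// ?nnegrE// ?(le_trans t0 tr)//.
by rewrite subr_ge0 ltW//; case/andP: al01.
Qed.

Lemma holder_const (F : Cplx R -> Cplx R) r : holder_loc_on UHPc al F -> 0 < r ->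
  exists2 c, 0 <= c & forall z u, UHPc z -> UHPc u -> cabs z <= r -> cabs u <= r ->
    cabs (F z - F u) <= c * powR (cabs (z - u)) al.
Proof.
move=> hF r0; have [c hc] := hF r r0; exists `|c| => // z u Sz Su zr ur.
by rewrite (le_trans (hc _ _ Sz Su zr ur))// ler_wpM2r ?powR_ge0// ler_norm.
Qed.

Lemma holder_bounded (F : Cplx R -> Cplx R) r : holder_loc_on UHPc al F -> 0 < r ->
  exists2 c, 0 <= c & forall z, UHPc z -> cabs z <= r -> cabs (F z) <= c.
Proof.
move=> hF r0; have [c c0 hc] := holder_const hF r0.
exists (cabs (F 0) + c * powR r al).
  by rewrite addr_ge0 ?cabs_ge0// mulr_ge0// powR_ge0.
move=> z Sz zr; rewrite -[F z](subrK (F 0)) addrC (le_trans (cabsD _ _))// lerD2l.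
rewrite (le_trans (hc _ _ Sz _ zr _))//; first by rewrite /UHPc /=.
  by rewrite cabs0 ltW.
rewrite ler_wpM2l// subr0 ge0_ler_powR// ?nnegrE ?cabs_ge0//; exact: ltW.
Qed.

Lemma holder_ext (F G : Cplx R -> Cplx R) : (forall z, UHPc z -> F z = G z) ->
  holder_loc_on UHPc al F -> holder_loc_on UHPc al G.
Proof.
move=> FG hF r r0; have [c hc] := hF r r0; exists c => z u Sz Su zr ur.
by rewrite -!FG//; exact: hc.
Qed.

Lemma holder_cst (k : Cplx R) : holder_loc_on UHPc al (fun=> k).
Proof. by move=> r r0; exists 0 => z u _ _ _ _; rewrite subrr cabs0 mul0r. Qed.

Lemma holder_id : holder_loc_on UHPc al (fun z => z).
Proof.
move=> r r0; exists (powR (r + r) (1 - al)) => z u _ _ zr ur.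
apply: powR_split; rewrite cabs_ge0/= (le_trans (cabsD _ _))//.
by rewrite cabsN lerD.
Qed.

Lemma holderD (F G : Cplx R -> Cplx R) : holder_loc_on UHPc al F ->
  holder_loc_on UHPc al G -> holder_loc_on UHPc al (fun z => F z + G z).
Proof.
move=> hF hG r r0; have [c hc] := hF r r0; have [d hd] := hG r r0.
exists (c + d) => z u Sz Su zr ur; rewrite opprD addrACA mulrDl.
by rewrite (le_trans (cabsD _ _))// lerD ?hc ?hd.
Qed.

Lemma holderM (F G : Cplx R -> Cplx R) : holder_loc_on UHPc al F ->
  holder_loc_on UHPc al G -> holder_loc_on UHPc al (fun z => F z * G z).
Proof.
move=> hF hG r r0.
have [c c0 hc] := holder_const hF r0; have [d d0 hd] := holder_const hG r0.
have [a a0 ha] := holder_bounded hF r0; have [b b0 hb] := holder_bounded hG r0.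
exists (a * d + c * b) => z u Sz Su zr ur.
have -> : F z * G z - F u * G u = F z * (G z - G u) + (F z - F u) * G u by ring.
rewrite (le_trans (cabsD _ _))// !cabsM mulrDl lerD//.
  by rewrite -mulrA ler_pM ?cabs_ge0 ?ha ?hd.
by rewrite mulrAC ler_pM ?cabs_ge0 ?hc ?hb.
Qed.

Lemma holderX (F : Cplx R -> Cplx R) n : holder_loc_on UHPc al F ->
  holder_loc_on UHPc al (fun z => F z ^+ n).
Proof.
move=> hF; elim: n => [|n IH]; first exact: holder_cst.
by under eq_fun do rewrite exprS; exact: holderM.
Qed.

Lemma holder_sum n (F : nat -> Cplx R -> Cplx R) :
  (forall i, holder_loc_on UHPc al (F i)) ->
  holder_loc_on UHPc al (fun z => \sum_(i < n) F i z).
Proof.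
move=> hF; elim: n => [|n IH].
  by under eq_fun do rewrite big_ord0; exact: holder_cst.
by under eq_fun do rewrite big_ord_recr; exact: holderD.
Qed.

Lemma holder_affine (F : Cplx R -> Cplx R) (a b : R) : 0 < a ->
  holder_loc_on UHPc al F ->
  holder_loc_on UHPc al (fun z => F (a%:C * z + b%:C)).
Proof.
move=> a0 hF r r0.
have r'0 : 0 < a * r + `|b| by rewrite ltr_pwDl// mulr_gt0.
have [c hc] := hF _ r'0; exists (c * powR a al) => z u Sz Su zr ur.
have bd w : cabs w <= r -> cabs (a%:C * w + b%:C) <= a * r + `|b|.
  move=> wr; rewrite (le_trans (cabsD _ _))// cabsM !cabs_real lerD//.
  by rewrite gtr0_norm// ler_pM2l.
have up w : UHPc w -> UHPc (a%:C * w + b%:C).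
  by rewrite /UHPc/= ImD ImM /= mul0r !addr0 => ?; rewrite mulr_ge0// ltW.
rewrite (le_trans (hc _ _ (up _ Sz) (up _ Su) (bd _ zr) (bd _ ur)))//.
rewrite opprD addrACA subrr addr0 -mulrBr cabsM cabs_real gtr0_norm//.
by rewrite powRM ?cabs_ge0// ?mulrA// ltW.
Qed.

End HolderCalculus.

(** * The logarithm on the closed upper half-plane *)

Section Logarithm.
Variable R : realType.
Local Open Scope complex_scope.
Implicit Types z u : Cplx R.

(* The branch of the logarithm on the closed upper half-plane with values of
   the argument in [0, pi]. *)
Definition carg z : R := acos (complex.Re z / cabs z).
Definition clog z : Cplx R := ln (cabs z) +i* carg z.

Lemma Re_div_itv z : -1 <= complex.Re z / cabs z <= 1.
Proof.
have [->|z0] := eqVneq z 0; first by rewrite /= mul0r lerN10 ler01.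
rewrite -ler_norml normrM normfV (ger0_norm (cabs_ge0 z)).
by rewrite ler_pdivrMr ?cabs_gt0// mul1r Re_le_cabs.
Qed.

Lemma carg_ge0 z : 0 <= carg z.
Proof. exact/acos_ge0/Re_div_itv. Qed.

Lemma carg_le_pi z : carg z <= pi.
Proof. exact/acos_lepi/Re_div_itv. Qed.

Lemma cos_carg z : cos (carg z) = complex.Re z / cabs z.
Proof. by rewrite acosK// in_itv /= Re_div_itv. Qed.

Lemma sin_carg z : z != 0 -> UHPc z -> sin (carg z) = complex.Im z / cabs z.
Proof.
move=> z0 hz; rewrite sin_acos ?Re_div_itv//.
have c0 : 0 < cabs z by rewrite cabs_gt0.
have -> : 1 - (complex.Re z / cabs z) ^+ 2 = (complex.Im z / cabs z) ^+ 2.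
  rewrite !expr_div_n; apply: (@mulIf _ (cabs z ^+ 2)); first by rewrite expf_neq0 ?gt_eqF.
  rewrite mulrBl !divfK ?expf_neq0 ?gt_eqF// mul1r sqr_cabs addrAC subrr add0r//.
by rewrite sqrtr_sqr ger0_norm// divr_ge0// cabs_ge0.
Qed.

Lemma abs_sin_le (t : R) : `|sin t| <= `|t|.
Proof.
wlog t0 : t / 0 < t.
  move=> W; have [t0|t0|t0] := ltgtP 0 t; [exact: W| |by rewrite -t0 sin0].
  by have := W (- t); rewrite sinN !normrN oppr_gt0; exact.
have [c _] : exists2 c, c \in `]0, t[%R & sin t - sin 0 = cos c * (t - 0).
  by apply: MVT => //; exact/continuous_subspaceT/continuous_sin.
rewrite sin0 !subr0 => ->; rewrite normrM ler_piMl// ler_norml.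
by rewrite cos_le1 cos_geN1.
Qed.

(** On [0, 1] the mean value theorem and [cos c >= 1 - c^2 / 2] give the better bound [s / 2];
    beyond 1, monotonicity and [pi / 2 < 2] suffice. *)
Lemma sin_ge_quarter (t : R) : 0 <= t <= pi / 2 -> t / 4 <= sin t.
Proof.
case/andP=> t0 tpi.
have pi2 := @pihalf_lt2 R.
have key (s : R) : 0 <= s <= 1 -> s / 2 <= sin s.
  case/andP; rewrite le_eqVlt => /predU1P[<- _|s0 s1]; first by rewrite sin0 mul0r.
  have [c] : exists2 c, c \in `]0, s[%R & sin s - sin 0 = cos c * (s - 0).
    by apply: MVT => //; exact/continuous_subspaceT/continuous_sin.
  rewrite in_itv/= sin0 !subr0 => /andP[c0 cs] ->.
  rewrite mulrC ler_pM2r//.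
  have -> : cos c = 1 - sin (c / 2) ^+ 2 *+ 2.
    by rewrite {1}(splitr c) cosD -!expr2 cos2sin2; ring.
  have : sin (c / 2) ^+ 2 <= (c / 2) ^+ 2.
    rewrite -[leLHS]real_normK ?num_real// -[leRHS]real_normK ?num_real//.
    by rewrite ler_pXn2r ?nnegrE ?abs_sin_le.
  by nra.
have [t1|t1] := leP t 1; first by have := key t; rewrite t0 t1 => /(_ isT); lra.
have := key 1; rewrite ler01 lexx => /(_ isT) k1.
suff : sin 1 <= sin t by lra.
by apply/ltW; rewrite ltr_sin// in_itv/=; apply/andP; split; lra.
Qed.

(** By the law of cosines [|z - u|^2 >= 4 |z| |u| sin^2 (d / 2)], with [d] the angle between [z] and
    [u]. Then [sin (d / 2) >= d / 8] and [|z| >= |u|] produce the constant 4. *)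
Lemma carg_lipschitz z u : z != 0 -> u != 0 -> UHPc z -> UHPc u ->
  cabs u <= cabs z -> cabs u * `|carg z - carg u| <= 4 * cabs (z - u).
Proof.
move=> z0 u0 hz hu uz.
set d := `|carg z - carg u|.
have d0 : 0 <= d by exact: normr_ge0.
have dpi : d <= pi.
  by rewrite ler_norml; have := carg_ge0 z; have := carg_ge0 u;
    have := carg_le_pi z; have := carg_le_pi u; lra.
have cz : 0 < cabs z by rewrite cabs_gt0.
have cu : 0 < cabs u by rewrite cabs_gt0.
have cosd : cos d = (complex.Re z * complex.Re u + complex.Im z * complex.Im u)
                    / (cabs z * cabs u).
  rewrite cos_norm cosB !cos_carg !sin_carg//.
  by field; rewrite !gt_eqF.
have E : cabs (z - u) ^+ 2 =
    (cabs z - cabs u) ^+ 2 + 2 * (cabs z * cabs u) * (1 - cos d).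
  have -> : 2 * (cabs z * cabs u) * (1 - cos d) = 2 * (cabs z * cabs u) -
      2 * (complex.Re z * complex.Re u + complex.Im z * complex.Im u).
    by rewrite cosd; field; rewrite !gt_eqF.
  by rewrite sqrrB !sqr_cabs ReD ImD ReN ImN; ring.
have cd : 1 - cos d = 2 * sin (d / 2) ^+ 2.
  by rewrite {1}(splitr d) cosD -!expr2 cos2sin2; ring.
have sd : d / 8 <= sin (d / 2).
  by have := @sin_ge_quarter (d / 2); rewrite divr_ge0//= ler_pM2r// dpi => /(_ isT); lra.
rewrite -(@ler_pXn2r _ 2) ?nnegrE ?mulr_ge0 ?cabs_ge0//.
rewrite [leRHS]exprMn E cd.
have : (d / 8) ^+ 2 <= sin (d / 2) ^+ 2 by rewrite ler_pXn2r// nnegrE; lra.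
set s := sin _ ^+ 2 => hs.
have : cabs u * cabs u * (d / 8) ^+ 2 <= cabs z * cabs u * s.
  by rewrite ler_pM ?mulr_ge0 ?sqr_ge0 ?cabs_ge0 ?ler_wpM2r ?cabs_ge0.
have := sqr_ge0 (cabs z - cabs u).
rewrite exprMn; nra.
Qed.

Lemma ln_lipschitz (a b : R) : 0 < b <= a -> b * (ln a - ln b) <= a - b.
Proof.
case/andP=> b0 ba; have a0 : 0 < a by exact: lt_le_trans ba.
rewrite -ln_div ?posrE//.
have -> : a - b = b * (a / b - 1) by field; rewrite gt_eqF.
rewrite ler_pM2l// -[X in ln X](subrK 1) addrC le_ln1Dx//.
have : 0 < a / b by rewrite divr_gt0.
by lra.
Qed.

(** Below 1, the inequality [x ln (1 / x) <= 1] at [x = t^b] costs [1 / b]; above 1,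
    [ln t <= t <= r]. The summand [pi] allows for the argument in [clog]. *)
Lemma powR_ln_bound (b r : R) : 0 < b < 1 -> 0 < r -> exists2 c, 0 <= c &
  forall t, 0 < t <= r -> powR t b * (`|ln t| + pi) <= c.
Proof.
move=> /andP[b0 b1] r0; exists (b^-1 + powR r b * (r + pi)).
  by rewrite addr_ge0 ?invr_ge0 ?(ltW b0)// mulr_ge0 ?powR_ge0// addr_ge0 ?pi_ge0// ltW.
move=> t /andP[t0 tr].
have pw : powR t b <= powR r b by rewrite ge0_ler_powR ?nnegrE// ltW.
rewrite (mulrDr (powR t b)) (mulrDr (powR r b)) addrA.
suff h : powR t b * `|ln t| <= b^-1 + powR r b * r.
  by have := ler_wpM2r (@pi_ge0 R) pw; lra.
have [t1|t1] := leP t 1.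
  rewrite ler_wpDr ?mulr_ge0 ?powR_ge0 ?(ltW r0)//.
  rewrite ler0_norm ?ln_le0// -[leRHS]mul1r ler_pdivlMr// -mulrA mulNr [ln t * b]mulrC -ln_powR mulrN.
  have p0 : 0 < powR t b by rewrite powR_gt0.
  have := @ln_lipschitz 1 (powR t b); rewrite p0 ln1 sub0r /=.
  have -> : powR t b <= 1.
    by have := @ge0_ler_powR R b (ltW b0) t 1; rewrite powR1 !nnegrE; apply=> //; exact: ltW.
  move/(_ isT); lra.
rewrite ler_wpDl ?invr_ge0 ?(ltW b0)//.
rewrite ger0_norm ?ln_ge0 ?(ltW t1)// ler_pM ?powR_ge0 ?ln_ge0 ?(ltW t1)//.
by have := ln_sublinear t0; lra.
Qed.

End Logarithm.

(** * Hölder continuity of z log z *)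

Section LogHolder.
Variables (R : realType) (al : R).
Hypothesis al01 : 0 < al < 1.
Local Open Scope complex_scope.

Lemma clog_norm_le (z : Cplx R) : cabs (clog z) <= `|ln (cabs z)| + pi.
Proof. by rewrite (le_trans (cabs_le _))//= lerD2l ger0_norm ?carg_ge0 ?carg_le_pi. Qed.

(** Split the difference as [(z - u) log z + u (log z - log u)] with [z] of larger modulus. In the
    first term [|z - u| <= 2 |z|] frees a factor [(2 |z|)^(1-al)], which absorbs the logarithm. The
    second is at most [5 |z - u|]: 1 from the modulus and 4 from the argument. *)
Lemma holder_zclog : holder_loc_on (@UHPc R) al (fun z => z * clog z).
Proof.
move=> r r0.
have b01 : 0 < 1 - al < 1 by case/andP: al01 => *; apply/andP; split; lra.
have r20 : 0 < r + r by rewrite addr_gt0.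
have [c c0 hc] := powR_ln_bound b01 r20.
have [c' c'0 hc'] := powR_ln_bound b01 r0.
pose K := powR 2 (1 - al) * c' + 5 * powR (r + r) (1 - al).
exists K => z u.
wlog uz : z u / cabs u <= cabs z.
  move=> W Sz Su zr ur; have [uz|/ltW zu] := leP (cabs u) (cabs z); first exact: W.
  by rewrite cabsC [cabs (z - u)]cabsC; exact: W.
move=> Sz Su zr ur.
have [z0|z0] := eqVneq z 0.
  have u0 : u = 0 by apply/eqP; rewrite -cabs_eq0 eq_le cabs_ge0 andbT -(@cabs0 R) -z0.
  by rewrite z0 u0 subrr cabs0 mulr_ge0 ?powR_ge0// addr_ge0 ?mulr_ge0 ?powR_ge0.
have cz : 0 < cabs z by rewrite cabs_gt0.
have -> : z * clog z - u * clog u = (z - u) * clog z + u * (clog z - clog u) by ring.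
rewrite (le_trans (cabsD _ _))// !cabsM mulrDl lerD//.
  have zu2 : cabs (z - u) <= 2 * cabs z.
    by rewrite (le_trans (cabsD _ _))// cabsN; lra.
  have := @powR_split _ _ al01 (cabs (z - u)) (2 * cabs z).
  rewrite cabs_ge0 zu2 => /(_ isT).
  rewrite powRM ?cabs_ge0// => h.
  rewrite (le_trans (ler_pM (cabs_ge0 _) (cabs_ge0 _) h (clog_norm_le z)))//.
  rewrite mulrAC ler_wpM2r ?powR_ge0// -mulrA ler_wpM2l ?powR_ge0//.
  by apply: hc'; rewrite cz.
have zur : cabs (z - u) <= r + r.
  by rewrite (le_trans (cabsD _ _))// cabsN lerD.
rewrite -mulrA.
apply: (@le_trans _ _ (5 * cabs (z - u))); last first.
  by rewrite ler_pM2l// (powR_split al01)// cabs_ge0.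
have [->|u0] := eqVneq u 0; first by rewrite cabs0 mul0r mulr_ge0 ?cabs_ge0.
have cu : 0 < cabs u by rewrite cabs_gt0.
apply: (@le_trans _ _ (cabs u * (ln (cabs z) - ln (cabs u)) + cabs u * `|carg z - carg u|)).
  rewrite -mulrDr ler_wpM2l ?cabs_ge0// (le_trans (cabs_le _))// /= lerD2r.
  by rewrite ger0_norm// subr_ge0 ler_ln.
have -> : 5 * cabs (z - u) = cabs (z - u) + 4 * cabs (z - u) by ring.
rewrite lerD ?carg_lipschitz//.
rewrite (le_trans (ln_lipschitz _)) ?cu//.
rewrite lerBlDr -[X in cabs X <= _](subrK u); exact: cabsD.
Qed.

Lemma holder_Xclog n : holder_loc_on (@UHPc R) al (fun z => z ^+ n.+1 * clog z).
Proof.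
under eq_fun do rewrite exprSr -mulrA.
apply: holderM => //; last exact: holder_zclog.
by apply: holderX => //; exact: holder_id.
Qed.

End LogHolder.

(** * Real integrals over a segment *)

Section Integral.
Variable R : realType.
Local Open Scope complex_scope.
Notation mu := (@lebesgue_measure R).

Definition itg (a b : R) (f : R -> R) : R := Rintegral mu `[a, b] f.

Lemma itg_integrable (a b : R) (f : R -> R) : continuous f ->
  mu.-integrable `[a, b] (EFin \o f).
Proof.
move=> cf; apply: continuous_compact_integrable; first exact: segment_compact.
exact: continuous_subspaceT.
Qed.

Lemma itgD (a b : R) (f g : R -> R) : continuous f -> continuous g ->
  itg a b (fun s => f s + g s) = itg a b f + itg a b g.
Proof. by move=> cf cg; rewrite /itg RintegralD//; exact: itg_integrable. Qed.

Lemma itgZ (a b k : R) (f : R -> R) : continuous f ->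
  itg a b (fun s => k * f s) = k * itg a b f.
Proof. by move=> cf; rewrite /itg RintegralZl//; exact: itg_integrable. Qed.

Lemma itgN (a b : R) (f : R -> R) : continuous f ->
  itg a b (fun s => - f s) = - itg a b f.
Proof.
by move=> cf; under eq_fun do rewrite -mulN1r; rewrite itgZ// mulN1r.
Qed.

Lemma itg_eq (a b : R) (f g : R -> R) : (forall s, a <= s <= b -> f s = g s) ->
  itg a b f = itg a b g.
Proof.
by move=> fg; apply: eq_Rintegral => s; rewrite inE/= in_itv/=; exact: fg.
Qed.

Lemma itg_le (a b : R) (f g : R -> R) : continuous f -> continuous g ->
  (forall s, a <= s <= b -> f s <= g s) -> itg a b f <= itg a b g.
Proof.
move=> cf cg fg; apply: le_Rintegral => //; try exact: itg_integrable.
Qed.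

Lemma itg_cst (a b k : R) : a <= b -> itg a b (fun=> k) = k * (b - a).
Proof.
move=> ab; rewrite /itg Rintegral_cst//. congr (_ * _).
apply: (etrans (congr1 fine (@lebesgue_measure_itv R `[a, b]%R))).
rewrite /= lte_fin.
by case: ltP => // ba; rewrite /= (_ : b = a) ?subrr//; apply/eqP; rewrite eq_le ab ba.
Qed.

Lemma itg_bound (a b k : R) (f : R -> R) : a <= b -> continuous f ->
  (forall s, a <= s <= b -> `|f s| <= k) -> `|itg a b f| <= k * (b - a).
Proof.
move=> ab cf fk; rewrite ler_norml -mulNr -!itg_cst//; apply/andP; split.
  by apply: itg_le => // [|s /fk]; [exact: cst_continuous|rewrite ler_norml => /andP[]].
by apply: itg_le => // [|s /fk]; [exact: cst_continuous|rewrite ler_norml => /andP[]].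
Qed.

Lemma itg_primitive (a b : R) (F f : R -> R) : a <= b -> continuous f ->
  (forall s : R, is_derive s (1 : R) F (f s)) -> itg a b f = F b - F a.
Proof.
rewrite le_eqVlt => /predU1P[->|ab] cf dF.
  by rewrite subrr /itg set_itv1 Rintegral_set1.
have cF : continuous F.
  by move=> s; apply: differentiable_continuous; apply/derivable1_diffP; have [] := dF s.
rewrite /itg /Rintegral (@continuous_FTC2 _ f F)//.
- exact: continuous_subspaceT.
- split=> [s _||]; first by have [] := dF s.
    exact/cvg_at_right_filter/cF.
  exact/cvg_at_left_filter/cF.
- by move=> s _; rewrite derive1E; have [_] := dF s.
Qed.

Lemma itg_support (D : set R) (a b : R) (f : R -> R) : [set` `[a, b]] `<=` D ->
  (forall s, D s -> ~~ (a <= s <= b) -> f s = 0) ->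
  Rintegral mu D f = itg a b f.
Proof.
move=> sub f0; rewrite /itg !(Rintegral_mkcond mu _ f); congr Rintegral.
apply/funext => s; rewrite !patchE.
case: ifPn; case: ifPn => //; rewrite ?inE ?notin_setE /=.
  by rewrite in_itv/= => /negP h Ds; exact: f0.
by move=> /sub.
Qed.

Lemma itg_affine (a b c d : R) (f : R -> R) : a <= b -> 0 < c -> continuous f ->
  itg a b (fun s => f (c * s + d)) = c^-1 * itg (c * a + d) (c * b + d) f.
Proof.
move=> ab c0 cf.
apply: (mulfI (lt0r_neq0 c0)); rewrite mulrA divff ?gt_eqF// mul1r.
have dF (s : R) : is_derive s (1 : R) (fun s => c * s + d) c.
  apply: is_derive_eq; rewrite addr0; exact: mulr1.
have cF : continuous (fun s : R => c * s + d).
  by move=> s; apply: differentiable_continuous; apply/derivable1_diffP; have [] := dF s.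
have F' : derive1 (fun s : R => c * s + d) = cst c.
  by apply/funext => s; rewrite derive1E; have [_] := dF s.
rewrite -itgZ; last by move=> s; apply: continuous_comp; [exact: cF|exact: cf].
rewrite [RHS]/itg /Rintegral.
rewrite (@integration_by_substitution_increasing _ (fun s => c * s + d) f a b)//.
- by congr fine; apply: eq_integral => s _; rewrite /= F' mulrC.
- by move=> x y _ _ xy; rewrite ltrD2r ltr_pM2l.
- by rewrite F' => x _; exact: cst_continuous.
- by rewrite F'; exact: is_cvg_cst.
- by rewrite F'; exact: is_cvg_cst.
- split=> [s _||]; first by have [] := dF s.
    exact/cvg_at_right_filter/cF.
  exact/cvg_at_left_filter/cF.
- exact: continuous_subspaceT.
Qed.

End Integral.

(** * Complex integrals over a segment; the integral of 1 / (s - z) *)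

Section ComplexIntegral.
Variable R : realType.
Local Open Scope complex_scope.
Notation C := (Cplx R).

Definition ccontinuous (f : R -> C) :=
  continuous (fun s => complex.Re (f s)) /\ continuous (fun s => complex.Im (f s)).

Definition citg (a b : R) (f : R -> C) : C :=
  itg a b (fun s => complex.Re (f s)) +i* itg a b (fun s => complex.Im (f s)).

Lemma ccontinuousD f g : ccontinuous f -> ccontinuous g -> ccontinuous (fun s => f s + g s).
Proof.
move=> [f1 f2] [g1 g2]; split => s.
  by under eq_fun do rewrite ReD; apply: cvgD; [exact: f1|exact: g1].
by under eq_fun do rewrite ImD; apply: cvgD; [exact: f2|exact: g2].
Qed.

Lemma ccontinuousM f g : ccontinuous f -> ccontinuous g -> ccontinuous (fun s => f s * g s).
Proof.
move=> [f1 f2] [g1 g2]; split => s.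
  under eq_fun do rewrite ReM; apply: cvgB; apply: cvgM;
    by [exact: f1|exact: g1|exact: f2|exact: g2].
under eq_fun do rewrite ImM; apply: cvgD; apply: cvgM;
  by [exact: f1|exact: g1|exact: f2|exact: g2].
Qed.

Lemma ccontinuous_real (f : R -> R) : continuous f -> ccontinuous (fun s => (f s)%:C).
Proof. by move=> cf; split => //= s; exact: cst_continuous. Qed.

Lemma ccontinuous_cst (k : C) : ccontinuous (fun=> k).
Proof. by split => s; exact: cst_continuous. Qed.

Lemma ccontinuousX f n : ccontinuous f -> ccontinuous (fun s => f s ^+ n).
Proof.
move=> cf; elim: n => [|n IH]; first exact: ccontinuous_cst.
by under eq_fun do rewrite exprS; exact: ccontinuousM.
Qed.

Lemma citg_eq a b f g : (forall s, a <= s <= b -> f s = g s) -> citg a b f = citg a b g.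
Proof. by move=> fg; congr Complex; apply: itg_eq => s /fg ->. Qed.

Lemma citgD a b f g : ccontinuous f -> ccontinuous g ->
  citg a b (fun s => f s + g s) = citg a b f + citg a b g.
Proof.
move=> [f1 f2] [g1 g2]; rewrite /citg.
under [in X in X +i* _]eq_fun do rewrite ReD; under [in X in _ +i* X]eq_fun do rewrite ImD.
by rewrite !itgD.
Qed.

Lemma citgZ a b (k : C) f : ccontinuous f ->
  citg a b (fun s => k * f s) = k * citg a b f.
Proof.
case: k => k l [f1 f2]; rewrite /citg.
under [in X in X +i* _]eq_fun do rewrite ReM/= -mulNr.
under [in X in _ +i* X]eq_fun do rewrite ImM/=.
have cZ (h : R -> R) (k' : R) : continuous h -> continuous (fun s => k' * h s).
  by move=> ch s; apply: cvgM; [exact: cst_continuous|exact: ch].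
by rewrite !itgD ?itgZ//; [|exact: cZ..]; rewrite mulNr.
Qed.

Lemma citg_sum a b n (f : nat -> R -> C) : (forall i, ccontinuous (f i)) ->
  citg a b (fun s => \sum_(i < n) f i s) = \sum_(i < n) citg a b (f i).
Proof.
move=> cf.
have cs k : ccontinuous (fun s => \sum_(i < k) f i s).
  elim: k => [|k IH]; first by under eq_fun do rewrite big_ord0; exact: ccontinuous_cst.
  by under eq_fun do rewrite big_ord_recr/=; exact: ccontinuousD.
elim: n => [|n IH].
  rewrite big_ord0; under eq_fun do rewrite big_ord0.
  have := @citgZ a b 0 (fun=> 0) (@ccontinuous_cst 0).
  by under eq_fun do rewrite mul0r; rewrite mul0r.
rewrite big_ord_recr/= -IH -citgD//.
by congr citg; apply/funext => s; rewrite big_ord_recr.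
Qed.

(** The factor 2 comes from bounding the real and imaginary parts separately. *)
Lemma citg_bound a b k f : a <= b -> ccontinuous f ->
  (forall s, a <= s <= b -> cabs (f s) <= k) -> cabs (citg a b f) <= 2 * k * (b - a).
Proof.
move=> ab [f1 f2] fk; rewrite (le_trans (cabs_le _))//= -mulrA mulr_natl mulr2n.
by rewrite lerD// itg_bound// => s /fk; apply: le_trans; rewrite (Re_le_cabs, Im_le_cabs).
Qed.

Lemma ccontinuous_sub (z : C) : ccontinuous (fun s => s%:C - z).
Proof.
apply: ccontinuousD; last exact: ccontinuous_cst.
by apply: ccontinuous_real => s; exact: cvg_id.
Qed.

Lemma ReV (z : C) : complex.Re z^-1 = complex.Re z / (complex.Re z ^+ 2 + complex.Im z ^+ 2).
Proof. by case: z. Qed.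

Lemma ImV (z : C) : complex.Im z^-1 = - complex.Im z / (complex.Re z ^+ 2 + complex.Im z ^+ 2).
Proof. by case: z => a b; rewrite /= mulNr. Qed.

Lemma sqr_sub_gt0 (z : C) (s : R) : UHP z ->
  0 < (complex.Re z - s) ^+ 2 + complex.Im z ^+ 2.
Proof. by move=> hz; rewrite ltr_wpDl ?sqr_ge0 ?exprn_gt0. Qed.

Lemma Re_inv_sub (z : C) (s : R) : complex.Re (s%:C - z)^-1 =
  - (complex.Re z - s) / ((complex.Re z - s) ^+ 2 + complex.Im z ^+ 2).
Proof. by rewrite ReV ReD ReN ImD ImN/= sub0r sqrrN -opprB sqrrN. Qed.

Lemma Im_inv_sub (z : C) (s : R) : complex.Im (s%:C - z)^-1 =
  complex.Im z / ((complex.Re z - s) ^+ 2 + complex.Im z ^+ 2).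
Proof. by rewrite ImV ReD ReN ImD ImN/= sub0r sqrrN opprK -opprB sqrrN. Qed.

Lemma continuous_sqr_sub (z : C) :
  continuous (fun s : R => (complex.Re z - s) ^+ 2 + complex.Im z ^+ 2).
Proof.
move=> s; apply: cvgD; last exact: cst_continuous.
by under eq_fun do rewrite expr2; apply: cvgM; apply: cvgB;
  by [exact: cst_continuous|exact: cvg_id].
Qed.

Lemma ccontinuous_inv_sub (z : C) : UHP z -> ccontinuous (fun s => (s%:C - z)^-1).
Proof.
move=> hz; split => s.
  under eq_fun do rewrite Re_inv_sub; apply: cvgM.
    by apply: cvgN; apply: cvgB; [exact: cst_continuous|exact: cvg_id].
  apply: cvgV; last exact: continuous_sqr_sub.
  by rewrite gt_eqF// sqr_sub_gt0.
under eq_fun do rewrite Im_inv_sub; apply: cvgM; first exact: cst_continuous.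
apply: cvgV; last exact: continuous_sqr_sub.
by rewrite gt_eqF// sqr_sub_gt0.
Qed.

Lemma cabs_sub_real (z : C) (s : R) :
  cabs (z - s%:C) = Num.sqrt ((complex.Re z - s) ^+ 2 + complex.Im z ^+ 2).
Proof. by rewrite cabsE ReD ReN ImD ImN/= oppr0 addr0. Qed.

Lemma ln_cabs_sub (z : C) (s : R) : UHP z -> ln (cabs (z - s%:C)) =
  2^-1 * ln ((complex.Re z - s) ^+ 2 + complex.Im z ^+ 2).
Proof.
move=> hz; rewrite cabs_sub_real; set D := _ + _.
have D0 : 0 < D by exact: sqr_sub_gt0.
rewrite -{2}[D]sqr_sqrtr ?(ltW D0)// lnXn ?sqrtr_gt0//.
by rewrite -[X in _ * X]mulr_natl mulrA mulVf// mul1r.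
Qed.

(** Trading the arccosine for an arctangent makes the argument a function of [s] with an evident
    rational derivative. *)
Lemma carg_sub (z : C) (s : R) : UHP z ->
  carg (z - s%:C) = pi / 2 - atan ((complex.Re z - s) / complex.Im z).
Proof.
move=> hz; set t := _ / complex.Im z.
have h1 := atan_gtNpi2 t; have h2 := atan_ltpi2 t.
rewrite -[RHS]cosK; last by rewrite in_itv/=; apply/andP; split; lra.
congr acos; rewrite cosB cos_pihalf sin_pihalf mul0r add0r mul1r.
rewrite ReD ReN/= cabs_sub_real.
have st0 : 0 < Num.sqrt (1 + t ^+ 2) by rewrite sqrtr_gt0 ltr_pwDl ?sqr_ge0.
have -> : sin (atan t) = t * cos (atan t).
  by rewrite -{2}[t]atanK /tan divfK// cos_atan invr_eq0 gt_eqF.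
rewrite cos_atan.
have -> : (complex.Re z - s) ^+ 2 + complex.Im z ^+ 2 = complex.Im z ^+ 2 * (1 + t ^+ 2).
  by rewrite /t; field; rewrite gt_eqF.
rewrite sqrtrM ?sqr_ge0// sqrtr_sqr gtr0_norm// /t.
by field; rewrite !gt_eqF.
Qed.

(** A primitive is [clog (z - s)]: as [s] varies, [z - s] stays in the open half-plane, so the
    branch never jumps. *)
Lemma citg_inv_sub (a b : R) (z : C) : a <= b -> UHP z ->
  citg a b (fun s => (s%:C - z)^-1) = clog (z - b%:C) - clog (z - a%:C).
Proof.
move=> ab hz; have [c1 c2] := ccontinuous_inv_sub hz.
apply/eqP; rewrite eq_complex; apply/andP; split; apply/eqP.
  rewrite [LHS]/= ReD ReN /= !ln_cabs_sub//.
  apply: (itg_primitive (F := fun s => 2^-1 * ln ((complex.Re z - s) ^+ 2 + complex.Im z ^+ 2))) => // s.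
  have D0 := sqr_sub_gt0 s hz.
  have dln := is_derive1_ln D0.
  apply: is_derive_eq.
  by rewrite Re_inv_sub /GRing.scale/=; field; rewrite gt_eqF.
rewrite [LHS]/= ImD ImN /= !carg_sub//.
apply: (itg_primitive (F := fun s => pi / 2 - atan ((complex.Re z - s) / complex.Im z))) => // s.
apply: is_derive_eq.
have D0 := sqr_sub_gt0 s hz; rewrite Im_inv_sub /GRing.scale/=.
have -> : 1 + ((complex.Re z - s) / complex.Im z) ^+ 2 =
    ((complex.Re z - s) ^+ 2 + complex.Im z ^+ 2) / complex.Im z ^+ 2.
  by field; rewrite gt_eqF.
by field; rewrite !gt_eqF.
Qed.

End ComplexIntegral.

(** * Iterated backward differences *)

Section Difference.
Variable K : comNzRingType.
Implicit Types (f g : K -> K) (x : K).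

(** Taken over a ring so that the same identities serve the real B-splines and their complex Cauchy
    transforms. *)
Definition bdiff (m : nat) f x : K :=
  \sum_(j < m.+1) (-1) ^+ j * 'C(m, j)%:R * f (x - j%:R).

Lemma bdiffS m f x : bdiff m.+1 f x = bdiff m f x - bdiff m f (x - 1).
Proof.
have E : bdiff m f x = f x + \sum_(j < m.+1) (-1) ^+ j.+1 * 'C(m, j.+1)%:R * f (x - j.+1%:R).
  transitivity (\sum_(j < m.+2) (-1) ^+ j * 'C(m, j)%:R * f (x - j%:R)).
    by rewrite [RHS]big_ord_recr/= bin_small// mulr0 mul0r addr0.
  by rewrite big_ord_recl/= expr0 bin0 !mul1r subr0.
rewrite E /bdiff [LHS]big_ord_recl/= expr0 bin0 !mul1r subr0 -addrA; congr (_ + _).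
rewrite -sumrB; apply: eq_bigr => j _.
rewrite /bump/= add1n binS natrD -addrA -opprD [1 + _]addrC natr1 exprS; ring.
Qed.

Lemma eq_bdiff m f g x : f =1 g -> bdiff m f x = bdiff m g x.
Proof. by move=> fg; apply: eq_bigr => j _; rewrite fg. Qed.

Lemma bdiff_shift m f x : bdiff m f (x - 1) = bdiff m (fun y => f (y - 1)) x.
Proof. by apply: eq_bigr => j _; rewrite -!addrA [- 1 + _]addrC. Qed.

Lemma bdiffB m f g x : bdiff m (fun y => f y - g y) x = bdiff m f x - bdiff m g x.
Proof. by rewrite -sumrB; apply: eq_bigr => j _; rewrite mulrBr. Qed.

Lemma bdiff_sum m n (c : nat -> K) (f : nat -> K -> K) x :
  bdiff m (fun y => \sum_(l < n) c l * f l y) x = \sum_(l < n) c l * bdiff m (f l) x.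
Proof.
rewrite /bdiff; under eq_bigr do rewrite mulr_sumr.
rewrite exchange_big/=; apply: eq_bigr => l _; rewrite mulr_sumr.
by apply: eq_bigr => j _; rewrite mulrCA.
Qed.

(** One backward difference turns [y^i] into a polynomial of degree [i - 1] with leading coefficient
    [i]; iterate. *)
Lemma bdiff_exp m i x : (i <= m)%N ->
  bdiff m (fun y => y ^+ i) x = if i == m then m`!%:R else 0.
Proof.
elim: m i x => [|m IH] i x; first by case: i => // _; rewrite /bdiff big_ord1 expr0 bin0 !mul1r.
move=> im; rewrite bdiffS bdiff_shift -bdiffB.
have E (y : K) : y ^+ i - (y - 1) ^+ i =
    \sum_(l < i) (- ((-1) ^+ (i - l) * 'C(i, l)%:R)) * y ^+ l.
  rewrite [y - 1]addrC exprDn big_ord_recr/= subnn expr0 binn mul1r mulr1n opprD addrCA subrr addr0.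
  by rewrite -sumrN; apply: eq_bigr => l _; rewrite -mulr_natr; ring.
rewrite (eq_bdiff _ _ E) (bdiff_sum m i (fun l => - ((-1) ^+ (i - l) * 'C(i, l)%:R)) (fun l y => y ^+ l)).
case: ltngtP im => // [im|->] _.
  rewrite big1// => l _; rewrite IH; last by rewrite -ltnS (leq_trans (ltn_ord l))// ltnW.
  by rewrite ltn_eqF ?mulr0// (leq_trans (ltn_ord l)).
rewrite big_ord_recr/= big1 ?add0r => [|l _]; last first.
  by rewrite IH ?(ltnW (ltn_ord l))// ltn_eqF// mulr0.
by rewrite IH// eqxx subSnn expr1 mulN1r opprK -natrM binSn -factS.
Qed.

End Difference.

(** * Cardinal B-splines of order n + 1 *)

Section BSpline.
Variables (R : realType) (n : nat).
Hypothesis n0 : (0 < n)%N.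
Implicit Types x : R.
Notation B := (@cardinal_bspline R n.+1).

Definition tpow x : R := Num.max x 0 ^+ n.

Lemma tpow_le0 x : x <= 0 -> tpow x = 0.
Proof. by move=> x0; rewrite /tpow max_r// expr0n gtn_eqF. Qed.

Lemma tpow_ge0 x : 0 <= x -> tpow x = x ^+ n.
Proof. by move=> x0; rewrite /tpow max_l. Qed.

Lemma bsplineE x : B x = n`!%:R^-1 * bdiff n.+1 tpow x.
Proof. by []. Qed.

Lemma bdiff_tpow_le0 m x : x <= 0 -> bdiff m tpow x = 0.
Proof.
move=> x0; apply: big1 => j _; rewrite tpow_le0 ?mulr0// subr_le0.
exact: le_trans x0 _.
Qed.

Lemma bdiff_tpow_ge m x : m%:R <= x -> bdiff m tpow x = bdiff m (fun y => y ^+ n) x.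
Proof.
move=> mx; apply: eq_bigr => j _; rewrite tpow_ge0// subr_ge0.
by rewrite (le_trans _ mx)// ler_nat -ltnS.
Qed.

Lemma bspline_le0 x : x <= 0 -> B x = 0.
Proof. by move=> x0; rewrite bsplineE bdiff_tpow_le0// mulr0. Qed.

(** Past the support every truncated power is a genuine power of degree [n], killed by a difference
    of order [n + 1]. *)
Lemma bspline_ge x : n.+1%:R <= x -> B x = 0.
Proof. by move=> nx; rewrite bsplineE bdiff_tpow_ge// bdiff_exp// ltn_eqF// mulr0. Qed.

(** Each translate is a difference of two consecutive values of the [n]-th difference, so the sum
    telescopes. The bound [n <= x] makes the first value [n!], and [x <= N] makes the last one
    vanish. *)
Lemma bspline_partition_unity N x : n%:R <= x <= N%:R ->
  \sum_(k < N) B (x - k%:R) = 1.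
Proof.
case/andP=> nx xN.
pose g k := bdiff n tpow (x - k%:R).
have E k : B (x - k%:R) = n`!%:R^-1 * (g k - g k.+1).
  by rewrite bsplineE bdiffS /g -addrA -opprD natr1.
under eq_bigr do rewrite E.
rewrite -mulr_sumr -(big_mkord xpredT (fun k => g k - g k.+1)).
under eq_bigr do rewrite -opprB.
rewrite sumrN telescope_sumr// opprB /g subr0 [X in _ - X]bdiff_tpow_le0 ?subr_le0// subr0.
by rewrite bdiff_tpow_ge// bdiff_exp// eqxx mulVf// pnatr_eq0 -lt0n fact_gt0.
Qed.

Lemma bspline_bounded : exists2 K, 0 <= K & forall x, `|B x| <= K.
Proof.
pose K := n`!%:R^-1 * \sum_(j < n.+2) `|(-1) ^+ j * 'C(n.+1, j)%:R : R| * n.+1%:R ^+ n.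
have K0 : 0 <= K.
  by rewrite mulr_ge0 ?invr_ge0// sumr_ge0// => j _; rewrite mulr_ge0// exprn_ge0.
exists K => // x.
have [nx|xn] := leP n.+1%:R x; first by rewrite bspline_ge// normr0.
rewrite bsplineE normrM ger0_norm ?invr_ge0// ler_wpM2l ?invr_ge0//.
rewrite (le_trans (ler_norm_sum _ _ _))//; apply: ler_sum => j _.
rewrite normrM ler_wpM2l// /tpow normrX ler_pXn2r ?nnegrE//.
rewrite ger0_norm ?le_max ?lexx ?orbT// ge_max ler0n andbT lerBlDr (le_trans (ltW xn))//.
by rewrite lerDl.
Qed.

Lemma continuous_tpow : continuous tpow.
Proof.
move=> x; rewrite /tpow.
have cm : continuous (fun y : R => Num.max y 0).
  by move=> y; apply: (@continuous_max R R id (cst 0)); [exact: cvg_id|exact: cst_continuous].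
by apply: (@continuous_comp _ _ _ (fun y : R => Num.max y 0) (fun y => y ^+ n)); [exact: cm|exact: exprn_continuous].
Qed.

Lemma continuous_bspline : continuous B.
Proof.
pose f (j : nat) (y : R) := (-1) ^+ j * 'C(n.+1, j)%:R * tpow (y - j%:R).
have cf j : continuous (f j).
  move=> x; apply: cvgM; first exact: cst_continuous.
  apply: (@continuous_comp _ _ _ (fun y : R => y - j%:R) tpow); last exact: continuous_tpow.
  by apply: cvgB; [exact: cvg_id|exact: cst_continuous].
have cs N : continuous (fun y => \sum_(j < N) f j y).
  elim: N => [|N IH] x; first by under eq_fun do rewrite big_ord0; exact: cst_continuous.
  by under eq_fun do rewrite big_ord_recr/=; apply: cvgD; [exact: IH|exact: cf].
rewrite (_ : B = fun y => n`!%:R^-1 * \sum_(j < n.+2) f j y)// => x.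
by apply: cvgM; [exact: cst_continuous|exact: cs].
Qed.

End BSpline.

(** * Cauchy transforms of powers *)

Section CauchyPower.
Variable R : realType.
Local Open Scope complex_scope.
Notation C := (Cplx R).

(** The integral over [a, b] of the polynomial quotient [((s - a)^n - (z - a)^n) / (s - z)]. *)
Fixpoint cauchy_poly (n : nat) (a b : R) (z : C) : C :=
  if n is n'.+1 then
    ((b - a) ^+ n / n%:R)%:C + (z - a%:C) * cauchy_poly n' a b z
  else 0.

Lemma itg_pow (n : nat) (a b : R) : a <= b ->
  itg a b (fun s => (s - a) ^+ n) = (b - a) ^+ n.+1 / n.+1%:R.
Proof.
move=> ab.
have dF (s : R) : is_derive s (1 : R) (fun s => n.+1%:R^-1 * (s - a) ^+ n.+1) ((s - a) ^+ n).
  have -> : (fun s => n.+1%:R^-1 * (s - a) ^+ n.+1) =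
      n.+1%:R^-1 *: ((fun s : R => s - a) ^+ n.+1) :> (R -> R).
    by apply/funext => t; rewrite !fctE.
  apply: is_derive_eq.
  by rewrite /GRing.scale/= subr0 mulr1 mulKf// pnatr_eq0.
rewrite (itg_primitive ab _ dF); first by rewrite subrr expr0n mulr0 subr0 mulrC.
move=> s; apply: (@continuous_comp _ _ _ (fun y : R => y - a) (fun y => y ^+ n)).
  by apply: cvgB; [exact: cvg_id|exact: cst_continuous].
exact: exprn_continuous.
Qed.

Lemma ccontinuous_pow (n : nat) (a : R) : ccontinuous (fun s => (s%:C - a%:C : C) ^+ n).
Proof. exact/ccontinuousX/ccontinuous_sub. Qed.

(* (s - a)^(n+1) / (s - z) = (s - a)^n + (z - a) (s - a)^n / (s - z). *)
Lemma citg_pow_inv_sub (n : nat) (a b : R) (z : C) : a <= b -> UHP z ->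
  citg a b (fun s => (s%:C - a%:C) ^+ n * (s%:C - z)^-1) =
  (z - a%:C) ^+ n * (clog (z - b%:C) - clog (z - a%:C)) + cauchy_poly n a b z.
Proof.
move=> ab hz; elim: n => [|n IH].
  rewrite expr0 mul1r addr0 -citg_inv_sub//; apply: citg_eq => s _.
  by rewrite expr0 mul1r.
transitivity (citg a b (fun s => ((s - a) ^+ n)%:C +
    (z - a%:C) * ((s%:C - a%:C) ^+ n * (s%:C - z)^-1))).
  apply: citg_eq => s _; rewrite rmorphXn rmorphB/= exprS.
  have sz : s%:C - z != 0.
    by rewrite eq_complex ImD ImN/= sub0r oppr_eq0 negb_and (gt_eqF hz) orbT.
  by field.
have c1 : ccontinuous (fun s => ((s - a) ^+ n)%:C : C).
  by under eq_fun do rewrite rmorphXn rmorphB; exact: ccontinuous_pow.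
have c2 : ccontinuous (fun s => (s%:C - a%:C) ^+ n * (s%:C - z)^-1).
  by apply: ccontinuousM; [exact: ccontinuous_pow|exact: ccontinuous_inv_sub].
rewrite citgD//; last by apply: ccontinuousM => //; exact: ccontinuous_cst.
rewrite citgZ// IH/= exprS /citg/= itg_pow// itg_cst// mul0r -/(real_complex _ _).
by ring.
Qed.

Lemma Im_cauchy_poly n (a b x : R) : complex.Im (cauchy_poly n a b x%:C) = 0.
Proof. by elim: n => //= n IH; rewrite ImD ImM IH/= subr0 !(mulr0,mul0r,addr0). Qed.

Lemma holder_cauchy_poly al n (a b : R) : 0 < al < 1 ->
  holder_loc_on (@UHPc R) al (cauchy_poly n a b).
Proof.
move=> al01; elim: n => [|n IH]; first exact: holder_cst.
apply: holderD => //; first exact: holder_cst.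
apply: holderM => //; apply: holderD => //; [exact: holder_id|exact: holder_cst].
Qed.

End CauchyPower.

(** * The Cauchy transform of a B-spline and its boundary values *)

Section BSplineCauchy.
Variables (R : realType) (n : nat).
Hypothesis n0 : (0 < n)%N.
Local Open Scope complex_scope.
Notation C := (Cplx R).
Notation B := (@cardinal_bspline R n.+1).

(* Closed form, continuous up to the real axis, of the Cauchy transform
   [int B(s) / (s - z) ds] of the cardinal B-spline. *)
Definition bspline_cauchy (z : C) : C := n`!%:R^-1 *
  \sum_(j < n.+2) (-1) ^+ j * 'C(n.+1, j)%:R *
    (cauchy_poly n j%:R n.+1%:R z - (z - j%:R) ^+ n * clog (z - j%:R)).

(** Cutting all truncated powers off at the common end [n + 1] yields, besides the closed form, the
    terms [(z - j)^n log (z - n - 1)]. Their weighted sum contains a difference of order [n + 1] of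
    [z^n], hence vanishes. *)
Lemma bspline_cauchyE (z : C) : UHP z ->
  bspline_cauchy z = citg 0 n.+1%:R (fun s => (B s)%:C * (s%:C - z)^-1).
Proof.
move=> hz; pose c j : C := (-1) ^+ j * 'C(n.+1, j)%:R.
have cinv := ccontinuous_inv_sub hz.
pose f j (s : R) : C := (tpow n (s - j%:R))%:C * (s%:C - z)^-1.
have cf j : ccontinuous (f j).
  apply: ccontinuousM => //; apply: ccontinuous_real => s.
  apply: (@continuous_comp _ _ _ (fun y : R => y - j%:R) (tpow n)); last exact: continuous_tpow.
  by apply: cvgB; [exact: cvg_id|exact: cst_continuous].
transitivity (citg 0 n.+1%:R (fun s => n`!%:R^-1 * \sum_(j < n.+2) c j * f j s)); last first.
  apply: citg_eq => s _; rewrite bsplineE /bdiff rmorphM fmorphV rmorph_nat -mulrA; congr (_ * _).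
  rewrite rmorph_sum mulr_suml; apply: eq_bigr => j _.
  by rewrite !rmorphM rmorphXn rmorphN rmorph1 rmorph_nat mulrA.
have ccf j : ccontinuous (fun s => c j * f j s).
  by apply: ccontinuousM => //; exact: ccontinuous_cst.
have csum k : ccontinuous (fun s => \sum_(j < k) c j * f j s).
  elim: k => [|k IH]; first by under eq_fun do rewrite big_ord0; exact: ccontinuous_cst.
  by under eq_fun do rewrite big_ord_recr/=; exact: ccontinuousD.
rewrite citgZ// (citg_sum _ _ _ ccf); congr (_ * _).
pose g j : C := cauchy_poly n j%:R n.+1%:R z - (z - j%:R) ^+ n * clog (z - j%:R).
have E (j : 'I_n.+2) : citg 0 n.+1%:R (fun s => c j * f j s) =
    c j * (z - j%:R) ^+ n * clog (z - n.+1%:R) + c j * g j.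
  rewrite citgZ//.
  have jn : j%:R <= n.+1%:R :> R by rewrite ler_nat -ltnS.
  have -> : citg 0 n.+1%:R (f j) =
      citg j%:R n.+1%:R (fun s => (s%:C - j%:R%:C) ^+ n * (s%:C - z)^-1).
    transitivity (citg j%:R n.+1%:R (f j)).
      have sub : [set` `[j%:R : R, n.+1%:R]] `<=` `[0, n.+1%:R].
        by apply: subset_itvr; rewrite bnd_simp.
      rewrite /citg; congr Complex; (apply: itg_support => // s; rewrite /= in_itv/= => /andP[_ sn];
        rewrite sn andbT -ltNge => /ltW sj; rewrite /f tpow_le0 ?subr_le0// mul0r//).
    apply: (@citg_eq R _ _ (f j)) => s /andP[js _].
    by rewrite /f tpow_ge0 ?subr_ge0// rmorphXn rmorphB.
  by rewrite citg_pow_inv_sub// !rmorph_nat /g; ring.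
under [RHS]eq_bigr do rewrite E.
rewrite big_split/= -mulr_suml.
have -> : \sum_(i < n.+2) c i * (z - i%:R) ^+ n = 0.
  by have := @bdiff_exp C n.+1 n z; rewrite /bdiff => ->//; rewrite ltn_eqF.
by rewrite mul0r add0r.
Qed.

(** Since [n > 0], each logarithm carries at least one factor [z - j], which tames its
    singularity. *)
Lemma holder_bspline_cauchy al : 0 < al < 1 ->
  holder_loc_on (@UHPc R) al bspline_cauchy.
Proof.
move=> al01; apply: holderM => //; first exact: holder_cst.
pose f j (z : C) := (-1) ^+ j * 'C(n.+1, j)%:R *
    (cauchy_poly n j%:R n.+1%:R z - (z - j%:R) ^+ n * clog (z - j%:R)).
apply: (@holder_sum _ _ _ f) => j; rewrite /f.
apply: holderM => //; first exact: holder_cst.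
apply: holderD => //; first exact: holder_cauchy_poly.
have hg : holder_loc_on (@UHPc R) al (fun z => -1 * ((z - j%:R) ^+ n * clog (z - j%:R))).
  apply: holderM => //; first exact: holder_cst.
  have := holder_affine (- j%:R) ltr01 (holder_Xclog al01 n.-1).
  apply: holder_ext => z _; rewrite prednK// mul1r.
  by rewrite rmorphN rmorph_nat.
by apply: holder_ext hg => z _; rewrite mulN1r.
Qed.

(** The argument is 0 on the positive axis and [pi] on the negative one, where the truncated power
    vanishes. At 0 the factor [x^n] hides the conventional value of the argument. *)
Lemma Im_pow_clog (x : R) :
  complex.Im (x%:C ^+ n * clog x%:C : C) = pi * (x ^+ n - tpow n x).
Proof.
rewrite -rmorphXn ImM/= mul0r addr0 /carg cabs_real/=.
have [x0|x0|<-] := ltgtP 0 x.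
- by rewrite gtr0_norm// divff ?gt_eqF// acos1 mulr0 tpow_ge0 ?subrr ?mulr0// ltW.
- by rewrite ltr0_norm// invrN mulrN divff ?lt_eqF// acosN1 tpow_le0 ?subr0 1?mulrC// ltW.
- by rewrite tpow_le0// subr0 expr0n gtn_eqF// mul0r mulr0.
Qed.

(** The Plemelj boundary value, read off the closed form: the polynomial terms are real, the full
    powers [x^n] cancel in the difference of order [n + 1], and the truncated powers remain. *)
Lemma Im_bspline_cauchy (x : R) : complex.Im (bspline_cauchy x%:C) = pi * B x.
Proof.
pose c j : R := (-1) ^+ j * 'C(n.+1, j)%:R.
have cE j : (-1) ^+ j * 'C(n.+1, j)%:R = (c j)%:C :> C.
  by rewrite rmorphM rmorphXn rmorphN rmorph1 rmorph_nat.
have e : n`!%:R^-1 = (n`!%:R^-1)%:C :> C by rewrite fmorphV rmorph_nat.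
have ImZ (k : R) (u : C) : complex.Im (k%:C * u) = k * complex.Im u.
  by rewrite ImM/= mul0r addr0.
rewrite /bspline_cauchy e ImZ Im_sum bsplineE mulrCA; congr (_ * _).
have -> : bdiff n.+1 (tpow n) x = - bdiff n.+1 (fun y => y ^+ n - tpow n y) x.
  by rewrite bdiffB bdiff_exp// ltn_eqF// sub0r opprK.
rewrite /bdiff -sumrN mulr_sumr; apply: eq_bigr => j _.
rewrite cE ImZ ImD ImN Im_cauchy_poly -(rmorph_nat (real_complex R)) -rmorphB Im_pow_clog.
by rewrite -/(c j); ring.
Qed.

Lemma ccontinuous_bspline : ccontinuous (fun s => (B s)%:C : C).
Proof. exact/ccontinuous_real/continuous_bspline. Qed.

(* [Im (1 / (s - z)) > 0], so [|Im F|] is at most [sup |B|] times the variation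
   of the argument of [s - z]. *)
Lemma bspline_cauchy_Im_bounded : exists2 K, 0 <= K &
  forall z : C, UHP z -> `|complex.Im (bspline_cauchy z)| <= K.
Proof.
have [K K0 BK] := @bspline_bounded R n n0; exists (K * pi); first by rewrite mulr_ge0// pi_ge0.
move=> z hz; rewrite bspline_cauchyE//=.
have [_ ci] := ccontinuous_inv_sub hz.
have cB := @continuous_bspline R n.
have -> : itg 0 n.+1%:R (fun s => complex.Im ((B s)%:C * (s%:C - z)^-1)) =
    itg 0 n.+1%:R (fun s => B s * complex.Im (s%:C - z)^-1).
  by apply: itg_eq => s _; rewrite ImM/= mul0r addr0.
have ge0 (s : R) : 0 <= complex.Im (s%:C - z)^-1.
  by rewrite Im_inv_sub divr_ge0// ltW// sqr_sub_gt0.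
have cBi : continuous (fun s => B s * complex.Im (s%:C - z)^-1).
  by move=> s; apply: cvgM; [exact: cB|exact: ci].
have cKi (k : R) : continuous (fun s : R => k * complex.Im (s%:C - z)^-1).
  by move=> s; apply: cvgM; [exact: cst_continuous|exact: ci].
pose A := itg 0 n.+1%:R (fun s => complex.Im (s%:C - z)^-1).
have A1 : A <= pi.
  have := congr1 (@complex.Im R) (@citg_inv_sub R 0 n.+1%:R z (ler0n _ _) hz).
  rewrite [X in X = _]/= -/A => ->; rewrite ImD ImN/=.
  by have := carg_ge0 (z - 0%:C); have := carg_le_pi (z - n.+1%:R%:C); lra.
have A0 : K * A <= K * pi by rewrite ler_wpM2l.
rewrite ler_norml; apply/andP; split.
  rewrite (@le_trans _ _ (- K * A)) ?mulNr ?lerN2// -mulNr -itgZ//; apply: itg_le => // s _.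
  by rewrite ler_wpM2r//; have := BK s; rewrite ler_norml => /andP[].
rewrite (@le_trans _ _ (K * A))// -itgZ//; apply: itg_le => // s _.
by rewrite ler_wpM2r//; have := BK s; rewrite ler_norml => /andP[].
Qed.

End BSplineCauchy.

(** * Complex differentiability with a quadratic remainder *)

Section QuadraticDerivative.
Variable R : realType.
Local Open Scope complex_scope.
Notation C := (Cplx R).
Implicit Types (f g : C -> C) (z l : C).

(** An explicit remainder reduces sums and affine substitutions to plain inequalities; filters enter
    only in [qdiff_cvg]. *)
Definition qdiff f z l := exists2 d : R, 0 < d & exists2 K : R, 0 <= K &
  forall u, cabs u < d -> cabs (f (z + u) - f z - l * u) <= K * cabs u ^+ 2.

Lemma qdiff_cvg f z l : qdiff f z l ->
  (fun h : C => (f (z + h) - f z) / h) @ (0 : C)^' --> l.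
Proof.
move=> [d d0 [K K0 hK]]; apply/cvgrPdist_le => /= e e0.
(* In the order of the complex numbers, [0 < e] forces [e] to be real. *)
have eE : e = (complex.Re e)%:C.
  by move: e0; rewrite ltcE/= => /andP[/eqP e1 _]; rewrite [e]complexE e1 mulr0 addr0.
have e'0 : 0 < complex.Re e by move: e0; rewrite ltcE/= => /andP[].
(* Dividing by [K + 1] rather than [K] admits [K = 0]. *)
have r0 : 0 < Num.min d (complex.Re e / (K + 1)).
  by rewrite lt_min d0 divr_gt0// ltr_pwDr.
have rC : (0 : C) < (Num.min d (complex.Re e / (K + 1)))%:C by rewrite ltcR.
near=> u.
have u0 : u != 0 by near: u; exact: (nbhs_dnbhs_neq (0 : C)).
have : `|u| < (Num.min d (complex.Re e / (K + 1)))%:C.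
  near: u. exact: (@dnbhs0_lt (Cplx R) (Cplx R) _ rC).
rewrite normE ltcR lt_min => /andP[ud ue].
rewrite eE normE lecR cabsC.
have -> : (f (z + u) - f z) / u - l = (f (z + u) - f z - l * u) / u by field.
have cu : 0 < cabs u by rewrite cabs_gt0.
rewrite cabsM cabsV ler_pdivrMr// (le_trans (hK _ ud))// expr2 mulrA ler_wpM2r ?(ltW cu)//.
move: ue; rewrite ltr_pdivlMr; last by rewrite ltr_pwDr.
by move: (cabs u) cu => v; nra.
Unshelve. all: by end_near. Qed.

Lemma qdiffD f g z l k : qdiff f z l -> qdiff g z k -> qdiff (fun u => f u + g u) z (l + k).
Proof.
move=> [d d0 [K K0 hK]] [e e0 [L L0 hL]].
exists (Num.min d e); first by rewrite lt_min d0.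
exists (K + L) => [|u]; first by rewrite addr_ge0.
rewrite lt_min => /andP[ud ue].
have -> : f (z + u) + g (z + u) - (f z + g z) - (l + k) * u =
  (f (z + u) - f z - l * u) + (g (z + u) - g z - k * u) by ring.
by rewrite (le_trans (cabsD _ _))// mulrDl lerD ?hK ?hL.
Qed.

Lemma qdiff_cst c z : qdiff (fun=> c) z 0.
Proof.
by exists 1 => //; exists 0 => // u _; rewrite subrr mul0r subr0 cabs0 mul0r.
Qed.

Lemma qdiffZ (c : C) f z l : qdiff f z l -> qdiff (fun u => c * f u) z (c * l).
Proof.
move=> [d d0 [K K0 hK]]; exists d => //; exists (cabs c * K) => [|u ud].
  by rewrite mulr_ge0 ?cabs_ge0.
rewrite -mulrA -!mulrBr cabsM -mulrA ler_wpM2l ?cabs_ge0//; exact: hK.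
Qed.

Lemma qdiff_affine (a b : C) f z l : a != 0 -> qdiff f (a * z + b) l ->
  qdiff (fun u => f (a * u + b)) z (l * a).
Proof.
move=> a0 [d d0 [K K0 hK]].
have ca : 0 < cabs a by rewrite cabs_gt0.
exists (d / cabs a); first by rewrite divr_gt0.
exists (K * cabs a ^+ 2) => [|u].
  by rewrite mulr_ge0// sqr_ge0.
rewrite ltr_pdivlMr// mulrC -cabsM => /hK.
have -> : a * z + b + a * u = a * (z + u) + b by ring.
by rewrite cabsM exprMn !mulrA.
Qed.

Lemma qdiff_sum n (f : nat -> C -> C) z : (forall k, exists l, qdiff (f k) z l) ->
  exists l, qdiff (fun u => \sum_(k < n) f k u) z l.
Proof.
move=> hf; elim: n => [|n [l IH]].
  by exists 0; under eq_fun do rewrite big_ord0; exact: qdiff_cst.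
have [k hk] := hf n; exists (l + k).
by under eq_fun do rewrite big_ord_recr/=; exact: qdiffD.
Qed.

End QuadraticDerivative.

(** * Supports and affine substitution in complex integrals *)

Section CIntegralTransfer.
Variable R : realType.
Local Open Scope complex_scope.
Notation C := (Cplx R).

Lemma citg_support (a b a' b' : R) (f : R -> C) : a' <= a -> b <= b' ->
  (forall s, ~~ (a <= s <= b) -> f s = 0) -> citg a' b' f = citg a b f.
Proof.
move=> aa bb f0; have sub : [set` `[a, b]] `<=` `[a', b'].
  by apply: subset_itv; rewrite bnd_simp.
by rewrite /citg; congr Complex; apply: itg_support => // s _ /f0 ->.
Qed.

Lemma cintegral_support (a b : R) (f : R -> C) :
  (forall s, ~~ (a <= s <= b) -> f s = 0) -> cintegral f = citg a b f.
Proof.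
move=> f0; rewrite /cintegral [RHS]complexE; congr (_%:C + 'i * _%:C);
  by apply: itg_support => // s _ /f0 ->.
Qed.

Lemma citg_affine (a b c d : R) (f : R -> C) : a <= b -> 0 < c -> ccontinuous f ->
  citg a b (fun s => f (c * s + d)) = (c^-1)%:C * citg (c * a + d) (c * b + d) f.
Proof.
move=> ab c0 [f1 f2]; rewrite /citg.
rewrite (@itg_affine _ _ _ _ _ (fun s => complex.Re (f s)))//.
rewrite (@itg_affine _ _ _ _ _ (fun s => complex.Im (f s)))//.
by apply/eqP; rewrite eq_complex ReM ImM/= !mul0r subr0 addr0 !eqxx.
Qed.

End CIntegralTransfer.

(** * Cauchy transforms of spline expansions and their membership in W^{m,p} *)

Section SplineCauchy.
Variables (R : realType) (n : nat).
Hypothesis n0 : (0 < n)%N.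
Local Open Scope complex_scope.
Notation C := (Cplx R).
Notation B := (@cardinal_bspline R n.+1).
Notation F := (@bspline_cauchy R n).

Lemma UHP_sub_neq0 (z : C) (s : R) : UHP z -> s%:C - z != 0.
Proof. by move=> hz; rewrite eq_complex ImD ImN/= sub0r oppr_eq0 negb_and (gt_eqF hz) orbT. Qed.

(** Differentiation under the integral through the exact identity [1/(s-z-u) = 1/(s-z) + u/(s-z)^2 +
    u^2/((s-z)^2 (s-z-u))]. For [|u| < y / 2] the point [z + u] stays above height [y / 2], which
    bounds the last term. *)
Lemma qdiff_bspline_cauchy (z : C) : UHP z -> exists l, qdiff F z l.
Proof.
move=> hz; have [K K0 BK] := @bspline_bounded R n n0.
set y := complex.Im z in hz *.
pose m : R := n.+1%:R.
pose f2 (s : R) : C := (B s)%:C * (s%:C - z)^-1 ^+ 2.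
exists (citg 0 m f2).
have y0 : 0 < y by exact: hz.
exists (y / 2); first by rewrite divr_gt0.
exists (2 * (K * (y^-1 ^+ 2 * (y / 2)^-1)) * m) => [|u ud].
  by rewrite !mulr_ge0 ?invr_ge0 ?sqr_ge0 ?(ltW y0) ?divr_ge0 ?(ltW y0)// ler0n.
have Imu : y / 2 < complex.Im (z + u).
  rewrite ImD -/y; have := le_lt_trans (Im_le_cabs u) ud.
  by rewrite ltr_norml => /andP[]; lra.
have hzu : UHP (z + u) by apply: lt_trans Imu; rewrite divr_gt0.
have c1 := ccontinuous_inv_sub hz; have c2 := ccontinuous_inv_sub hzu.
have cB := ccontinuous_bspline R n.
pose f3 (s : R) : C := (B s)%:C * ((s%:C - z)^-1 ^+ 2 * (s%:C - (z + u))^-1).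
have cf2 : ccontinuous f2 by apply: ccontinuousM => //; exact: ccontinuousX.
have cf3 : ccontinuous f3.
  by do 2 apply: ccontinuousM => //; exact: ccontinuousX.
have -> : F (z + u) = F z + u * citg 0 m f2 + u ^+ 2 * citg 0 m f3.
  rewrite !bspline_cauchyE// -!citgZ// -!citgD//; last first.
  - by apply: ccontinuousM => //; exact: ccontinuous_cst.
  - by apply: ccontinuousM.
  - by apply: ccontinuousM => //; exact: ccontinuous_cst.
  - by apply: ccontinuousD; apply: ccontinuousM => //; exact: ccontinuous_cst.
  apply: citg_eq => s _; rewrite /f2 /f3.
  have := UHP_sub_neq0 s hz; have := UHP_sub_neq0 s hzu => h1 h2.
  by field; rewrite h1 h2.
have -> : F z + u * citg 0 m f2 + u ^+ 2 * citg 0 m f3 - F z - citg 0 m f2 * u =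
  u ^+ 2 * citg 0 m f3 by ring.
rewrite cabsM cabsX mulrC ler_wpM2r ?sqr_ge0// -[X in _ * X]subr0 citg_bound ?ler0n// => s _.
have inv (w : C) (r : R) : 0 < r -> r <= complex.Im w -> cabs (s%:C - w)^-1 <= r^-1.
  move=> r0 rw; rewrite cabsV lef_pV2 ?posrE//; last first.
    by rewrite cabs_gt0; apply: UHP_sub_neq0; exact: lt_le_trans rw.
  by rewrite (le_trans _ (Im_le_cabs _))// ImD ImN/= sub0r normrN (le_trans rw)// ler_norm.
rewrite /f3 cabsM cabs_real cabsM cabsX ler_pM ?mulr_ge0 ?sqr_ge0 ?cabs_ge0// ler_pM ?sqr_ge0 ?cabs_ge0//.
  by rewrite ler_pXn2r ?nnegrE ?cabs_ge0 ?invr_ge0 ?(ltW y0)// inv.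
by rewrite inv ?divr_gt0// ltW.
Qed.

Variables (x0 h : R) (N : nat) (c : nat -> R).
Hypothesis h0 : 0 < h.

(** The form [ds / (s - z)] is invariant under affine maps, so rescaling the grid brings in no power
    of [h]. *)
Definition spline_cauchy (z : C) : C :=
  \sum_(k < N) (c k)%:C * F ((h^-1)%:C * z + (- (x0 / h) - k%:R)%:C).

Definition spline (x : R) : R := \sum_(k < N) c k * B ((x - x0) / h - k%:R).

Let argE (x : R) (k : nat) : (x - x0) / h - k%:R = h^-1 * x + (- (x0 / h) - k%:R).
Proof. by rewrite mulrBl addrA [x / h]mulrC. Qed.

Let UHP_affine (z : C) (d : R) : UHP z -> UHP ((h^-1)%:C * z + d%:C).
Proof.
by rewrite /UHP/= ImD ImM/= mul0r !addr0 => ?; rewrite mulr_gt0// invr_gt0.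
Qed.

Lemma spline_cauchy_real (x : R) : complex.Im (spline_cauchy x%:C) = pi * spline x.
Proof.
rewrite Im_sum mulr_sumr; apply: eq_bigr => k _.
rewrite ImM/= mul0r addr0 -rmorphM -rmorphD Im_bspline_cauchy// argE mulrCA.
by rewrite mulrA.
Qed.

Lemma Re_spline_cauchy (x : R) : complex.Re (spline_cauchy x%:C) =
  \sum_(k < N) c k * complex.Re (F ((x - x0) / h - k%:R)%:C).
Proof.
rewrite Re_sum; apply: eq_bigr => k _.
by rewrite ReM/= mul0r subr0 -rmorphM -rmorphD argE.
Qed.

Lemma qdiff_spline_cauchy (z : C) : UHP z -> exists l, qdiff spline_cauchy z l.
Proof.
move=> hz.
apply: (@qdiff_sum _ N (fun k z => (c k)%:C * F ((h^-1)%:C * z + (- (x0 / h) - k%:R)%:C))) => k.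
have [l hl] := qdiff_bspline_cauchy (UHP_affine (- (x0 / h) - k%:R) hz).
exists ((c k)%:C * (l * (h^-1)%:C)); apply: qdiffZ; apply: qdiff_affine => //.
by rewrite eq_complex/= eqxx andbT invr_eq0 gt_eqF.
Qed.

Lemma analytic_spline_cauchy : analytic_on (@UHP R) spline_cauchy.
Proof. by move=> z /qdiff_spline_cauchy[l hl]; exists l; exact: qdiff_cvg. Qed.

Lemma holder_spline_cauchy al : 0 < al < 1 ->
  holder_loc_on (@UHPc R) al spline_cauchy.
Proof.
move=> al01; apply: (@holder_sum _ _ _ (fun k z => (c k)%:C * F ((h^-1)%:C * z + (- (x0 / h) - k%:R)%:C))) => k.
apply: holderM => //; first exact: holder_cst.
by apply: holder_affine => //; [rewrite invr_gt0|exact: holder_bspline_cauchy].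
Qed.

(* The constant function [i K] is Herglotz, and so is [Q + i K] as soon as
   [Im Q >= - K]. *)
Lemma quasi_herglotz_spline_cauchy : quasi_herglotz spline_cauchy.
Proof.
split; first exact: analytic_spline_cauchy.
have [K K0 hK] := @bspline_cauchy_Im_bounded R n n0.
pose L := \sum_(k < N) `|c k| * K.
have L0 : 0 <= L by apply: sumr_ge0 => k _; rewrite mulr_ge0.
have ImQ z : UHP z -> `|complex.Im (spline_cauchy z)| <= L.
  move=> hz; rewrite Im_sum (le_trans (ler_norm_sum _ _ _))//; apply: ler_sum => k _.
  by rewrite ImM/= mul0r addr0 normrM ler_wpM2l// hK//; exact: UHP_affine.
exists (fun z => spline_cauchy z + (0 +i* L)), (fun=> 0 +i* L); split; last split.
- split=> [z hz|z hz].
    have [l hl] := qdiff_spline_cauchy hz; exists (l + 0).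
    exact: (@qdiff_cvg _ (fun u => spline_cauchy u + (0 +i* L)) z _ (qdiffD hl (qdiff_cst _ _))).
  by rewrite ImD/=; have := ImQ _ hz; rewrite ler_norml => /andP[]; lra.
- split=> [z hz|z hz]; last exact: L0.
  by exists 0; exact: (@qdiff_cvg _ (fun=> 0 +i* L) z 0 (qdiff_cst _ _)).
- by move=> z _; rewrite addrK.
Qed.

Lemma spline_support (x : R) : ~~ (x0 <= x <= x0 + h * (N + n.+1)%:R) -> spline x = 0.
Proof.
rewrite negb_and -!ltNge => hx; apply: big1 => k _.
have [xx|xx] := orP hx.
  by rewrite bspline_le0 ?mulr0// lerBlDr add0r (@le_trans _ _ 0)// ler_pdivrMr// mul0r subr_le0 ltW.
rewrite bspline_ge ?mulr0// lerBrDr ler_pdivlMr// lerBrDl.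
rewrite (le_trans _ (ltW xx))// lerD2l mulrC ler_pM2l// -natrD ler_nat addnC leq_add2r.
exact: ltnW.
Qed.

Lemma continuous_spline : continuous spline.
Proof.
pose f k (x : R) := c k * B ((x - x0) / h - k%:R).
have cf k : continuous (f k).
  move=> x; apply: cvgM; first exact: cst_continuous.
  apply: (@continuous_comp _ _ _ (fun y : R => (y - x0) / h - k%:R) B); last exact: continuous_bspline.
  apply: cvgB; last exact: cst_continuous.
  apply: cvgM; last exact: cst_continuous.
  by apply: cvgB; [exact: cvg_id|exact: cst_continuous].
rewrite /spline; elim: N => [|k IH] x.
  by under eq_fun do rewrite big_ord0; exact: cst_continuous.
by under eq_fun do rewrite big_ord_recr/=; apply: cvgD; [exact: IH|exact: cf].
Qed.

Lemma citg_spline (z : C) : UHP z ->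
  citg x0 (x0 + h * (N + n.+1)%:R) (fun s => (spline s)%:C * (s%:C - z)^-1) = spline_cauchy z.
Proof.
move=> hz; set b := x0 + _.
have cinv := ccontinuous_inv_sub hz.
pose d k := - (x0 / h) - k%:R.
pose g k (s : R) : C := (B s)%:C * (s%:C - ((h^-1)%:C * z + (d k)%:C))^-1.
have cg k : ccontinuous (g k).
  apply: ccontinuousM; first exact: ccontinuous_bspline.
  exact/ccontinuous_inv_sub/UHP_affine.
have cgd k : ccontinuous (fun s => g k (h^-1 * s + d k)).
  have [g1 g2] := cg k.
  have ca : continuous (fun s : R => h^-1 * s + d k).
    move=> s; apply: cvgD; last exact: cst_continuous.
    by apply: cvgM; [exact: cst_continuous|exact: cvg_id].
  by split => s; [apply: (@continuous_comp R R R (fun s => h^-1 * s + d k) (fun s => complex.Re (g k s)))|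
    apply: (@continuous_comp R R R (fun s => h^-1 * s + d k) (fun s => complex.Im (g k s)))]; 
    [exact: ca|exact: g1|exact: ca|exact: g2].
transitivity (citg x0 b (fun s => \sum_(k < N) (c k / h)%:C * g k (h^-1 * s + d k))).
  apply: citg_eq => s _; rewrite rmorph_sum mulr_suml; apply: eq_bigr => k _.
  rewrite argE -/(d k) /g; move: (B _) => v.
  rewrite !rmorphM fmorphV -!mulrA; congr (_ * _).
  rewrite mulrCA; congr (_ * _).
  have hC : h%:C != 0 :> C by rewrite eq_complex/= eqxx andbT gt_eqF.
  have -> : (h^-1 * s + d k)%:C - ((h^-1)%:C * z + (d k)%:C) = h%:C^-1 * (s%:C - z) :> C.
    have hV : (h^-1)%:C = h%:C^-1 :> C by exact: fmorphV.
    by rewrite rmorphD rmorphM /= hV; ring.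
  by rewrite invfM invrK mulrA mulVf// mul1r.
pose G k (s : R) : C := (c k / h)%:C * g k (h^-1 * s + d k).
have cG k : ccontinuous (G k) by apply: ccontinuousM => //; exact: ccontinuous_cst.
rewrite (citg_sum _ _ _ cG); apply: eq_bigr => k _.
have xb : x0 <= b by rewrite lerDl mulr_ge0// ltW.
rewrite /G citgZ// citg_affine ?invr_gt0// invrK mulrA -rmorphM divfK ?gt_eqF//.
congr (_ * _); rewrite bspline_cauchyE//; last exact: UHP_affine.
apply: citg_support.
- by rewrite /d addrA [h^-1 * _]mulrC subrr sub0r oppr_le0.
- rewrite /b mulrDr mulKf ?gt_eqF// /d [h^-1 * _]mulrC addrACA subrr add0r lerBrDr -natrD ler_nat addnC leq_add2r.
  exact: ltnW.
- move=> s; rewrite negb_and -!ltNge /g => /orP[/ltW s0|/ltW s1].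
    by rewrite bspline_le0// mul0r.
  by rewrite bspline_ge// mul0r.
Qed.

(** The density has compact support, so the term [xi / (1 + xi^2)] can be integrated separately; the
    real constant [a] compensates it and [b = 0]. *)
Lemma nevanlinna_spline_cauchy : exists a b, nevanlinna_repr a b spline spline_cauchy.
Proof.
pose e := x0 + h * (N + n.+1)%:R.
pose w (s : R) := s / (1 + s ^+ 2).
have cw : continuous w.
  have D0 (s : R) : 1 + s ^+ 2 != 0 by rewrite gt_eqF// ltr_pwDl// sqr_ge0.
  move=> s; apply: cvgM; first exact: cvg_id.
  apply: cvgV => //; apply: cvgD; first exact: cst_continuous.
  exact: exprn_continuous.
have csp : ccontinuous (fun s => (spline s)%:C : C) by exact/ccontinuous_real/continuous_spline.
have cws : ccontinuous (fun s => (w s)%:C * (spline s)%:C : C).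
  by apply: ccontinuousM => //; exact: ccontinuous_real.
exists (itg x0 e (fun s => w s * spline s)), 0 => z hz.
have cinv := ccontinuous_inv_sub hz.
rewrite mul0r addr0 (cintegral_support (a := x0) (b := e)); last first.
  by move=> s /spline_support ->; rewrite mulr0.
have -> : (itg x0 e (fun s => w s * spline s))%:C =
    citg x0 e (fun s => (w s)%:C * (spline s)%:C).
  rewrite /citg; apply/eqP; rewrite eq_complex/=; apply/andP; split; apply/eqP.
    by apply: itg_eq => s _; rewrite mul0r subr0.
  have -> : (fun s : R => w s * 0 + 0 * spline s) = fun=> 0.
    by apply/funext => s; rewrite mulr0 mul0r addr0.
  by rewrite itg_cst ?mul0r// lerDl mulr_ge0// ltW.
rewrite -citg_spline// -citgD//; last first.
  by apply: ccontinuousM => //; apply: ccontinuousD => //; 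
    have := ccontinuous_real (fun s => continuousN (cw s)); under eq_fun do rewrite rmorphN.
by apply: citg_eq => s _; rewrite -/(w s); ring.
Qed.

Lemma W_m_spline_cauchy (Om : set R) al M : 0 < al < 1 ->
  (forall x, Om x -> `|x| <= M) ->
  W_m Om al n.+1 (fun x => spline_cauchy (realC x)).
Proof.
move=> al01 OmM; have hQ := holder_spline_cauchy al01.
split.
  have M0 : 0 < `|M| + 1 by rewrite ltr_pwDr.
  have [k hk] := hQ _ M0; exists k => x y Ox Oy.
  have bd t : Om t -> cabs (realC t) <= `|M| + 1.
    by move=> /OmM tM; rewrite cabs_real (le_trans tM)// (le_trans (ler_norm _))// lerDl.
  have up t : UHPc (realC t : C) by rewrite /UHPc/=.
  rewrite (le_trans (hk (realC x) (realC y) _ _ (bd _ Ox) (bd _ Oy)))//; try exact: up.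
  by rewrite -rmorphB cabs_real.
exists spline_cauchy; split.
  split; first exact: quasi_herglotz_spline_cauchy.
  (* The extension is Hölder on bounded parts of the whole closed half-plane, so all of the real
     line serves as neighbourhood. *)
  exists setT; split; [exact: openT|split => //; split => //].
  move=> r r0; have [k hk] := hQ r r0; exists k => z u Sz Su; apply: hk.
    by rewrite /UHPc/=; case: Sz => [/ltW//|[/= -> _]].
  by rewrite /UHPc/=; case: Su => [/ltW//|[/= -> _]].
have [a [b hab]] := nevanlinna_spline_cauchy.
by exists a, b, spline; split => //; exists x0, h, N, c.
Qed.

End SplineCauchy.

(** * Moments of the binomial law *)

Section Bernstein.
Variable R : realFieldType.
Implicit Types (y : R) (f g : nat -> R).

(* Expectation of [g] under the binomial law of parameters [N] and [y]. *)
Fixpoint bernstein (N : nat) y g : R :=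
  if N is N'.+1 then
    y * bernstein N' y (fun k => g k.+1) + (1 - y) * bernstein N' y g
  else g 0%N.

Lemma eq_bernstein N y f g : f =1 g -> bernstein N y f = bernstein N y g.
Proof.
elim: N f g => [|N IH] f g fg /=; first exact: fg.
by rewrite (IH _ _ fg) (IH _ (fun k => g k.+1)).
Qed.

Lemma bernsteinD N y f g :
  bernstein N y (fun k => f k + g k) = bernstein N y f + bernstein N y g.
Proof. by elim: N f g => //= N IH f g; rewrite !IH; ring. Qed.

Lemma bernsteinZ N y (a : R) g :
  bernstein N y (fun k => a * g k) = a * bernstein N y g.
Proof. by elim: N g => //= N IH g; rewrite !IH; ring. Qed.

Lemma bernstein_cst N y (a : R) : bernstein N y (fun=> a) = a.
Proof. by elim: N => //= N ->; ring. Qed.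

Lemma ler_bernstein N y f g : 0 <= y <= 1 -> (forall k, f k <= g k) ->
  bernstein N y f <= bernstein N y g.
Proof.
case/andP=> y0 y1; elim: N f g => /= [|N IH] f g fg; first exact: fg.
by rewrite lerD// ler_wpM2l// ?IH// subr_ge0.
Qed.

Lemma bernstein_mean N y : bernstein N y (fun k => k%:R) = N%:R * y.
Proof.
elim: N => [|N IH] /=; first by rewrite mul0r.
have -> : bernstein N y (fun k => k.+1%:R) = N%:R * y + 1.
  rewrite -IH -[X in _ + X](bernstein_cst N y) -bernsteinD.
  by apply: eq_bernstein => k; rewrite natr1.
by rewrite IH -natr1; ring.
Qed.

(** A further trial adds [1 - y] or [-y] to the deviation [k - N y]. The cross term has mean 0, so
    the variance grows by [y (1-y)^2 + (1-y) y^2 = y (1-y)]. *)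
Lemma bernstein_variance N y :
  bernstein N y (fun k => (k%:R - N%:R * y) ^+ 2) = N%:R * (y * (1 - y)).
Proof.
elim: N => [|N IH] /=; first by rewrite !mul0r subr0 expr0n.
pose v k : R := (k%:R - N%:R * y) ^+ 2.
have E (a : R) : bernstein N y (fun k => v k + (2 * a * k%:R + (a ^+ 2 - 2 * a * (N%:R * y)))) =
    N%:R * (y * (1 - y)) + a ^+ 2.
  by rewrite !bernsteinD bernsteinZ bernstein_mean !bernstein_cst IH; ring.
rewrite (eq_bernstein _ _ (g := fun k => v k + (2 * (1 - y) * k%:R + ((1 - y) ^+ 2 - 2 * (1 - y) * (N%:R * y))))); last first.
  by move=> k; rewrite /v -!natr1; ring.
rewrite (eq_bernstein _ _ (f := fun k => (k%:R - N.+1%:R * y) ^+ 2) (g := fun k => v k + (2 * (- y) * k%:R + ((- y) ^+ 2 - 2 * (- y) * (N%:R * y))))); last first.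
  by move=> k; rewrite /v -!natr1; ring.
by rewrite !E -natr1; ring.
Qed.

Lemma bernstein_poly N g : exists p : {poly R}, forall y, p.[y] = bernstein N y g.
Proof.
elim: N g => [|N IH] g; first by exists (g 0%N)%:P => y; rewrite hornerC.
have [p hp] := IH (fun k => g k.+1); have [q hq] := IH g.
by exists ('X * p + (1 - 'X) * q) => y; rewrite !hornerE hp hq.
Qed.

End Bernstein.

(** * Weierstrass approximation on a bounded set of reals *)

Section Weierstrass.
Variable R : realType.

(* Bernstein's proof; the nodes [L k / N] need not belong to the set [A], so
   [f] is sampled at almost nearest points of [A] instead. *)
Lemma weierstrass (A : set R) (f : R -> R) (L : R) : 0 < L ->
  (forall t, A t -> 0 <= t <= L) ->
  (forall e, 0 < e -> exists2 K, 0 <= K & forall s t, A s -> A t ->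
     `|f s - f t| <= e + K * (s - t) ^+ 2) ->
  forall e, 0 < e -> exists p : {poly R}, forall t, A t -> `|f t - p.[t]| <= e.
Proof.
move=> L0 AL hf e e0.
have [A0|A0] := pselect (A = set0); first by exists 0 => t; rewrite A0.
(* Error budget: [e / 4] from the modulus of continuity, [2 K eta^2 <= e / 4] from sampling off the
   nodes, [e / 2] from the variance. *)
have e4 : 0 < e / 4 by rewrite divr_gt0.
have [K K0 hK] := hf _ e4.
have K1 : 0 < K + 1 by rewrite ltr_pwDr.
pose eta := Num.min 1 (e / (8 * (K + 1))).
have eta0 : 0 < eta by rewrite lt_min ltr01 divr_gt0// mulr_gt0.
have etae : K * eta ^+ 2 <= e / 8.
  have h1 : eta ^+ 2 <= eta by rewrite expr2 ler_piMr ?(ltW eta0)// ge_min lexx.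
  have h2 : (K + 1) * eta <= e / 8.
    have : eta <= e / (8 * (K + 1)) by rewrite ge_min lexx orbT.
    by rewrite ler_pdivlMr ?mulr_gt0//; lra.
  by nra.
pose N := (Num.bound (16 * K * L ^+ 2 / e)).+1.
have NB : K * (8 * (L ^+ 2 / N%:R)) <= e / 2.
  have /ltW : 16 * K * L ^+ 2 / e < N%:R.
    rewrite (lt_le_trans (archi_boundP _))// ?ler_nat// divr_ge0 ?(ltW e0)//.
    by rewrite mulr_ge0 ?sqr_ge0// mulr_ge0.
  rewrite ler_pdivrMr// => hN.
  rewrite !mulrA ler_pdivrMr ?ltr0n//; lra.
have near t : exists2 a, A a & forall x, A x -> `|a - t| <= `|x - t| + eta.
  have [x0 Ax0] : exists x, A x.
    by apply: contrapT => h; apply: A0; rewrite -subset0 => x Ax; apply: h; exists x.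
  pose D := [set `|x - t| | x in A].
  have Dinf : has_inf D.
    by split; [exists `|x0 - t|, x0|exists 0 => _ [x _ <-]].
  have [_ [a Aa <-] ha] := inf_adherent eta0 Dinf.
  exists a => // x Ax; rewrite (le_trans (ltW ha))// lerD2r.
  by apply: ge_inf; [exact: Dinf.2|exists x].
pose a k := sval (cid2 (near (L * (k%:R / N%:R)))).
have Aa k : A (a k) by rewrite /a; case: cid2.
have aP k x : A x -> `|a k - L * (k%:R / N%:R)| <= `|x - L * (k%:R / N%:R)| + eta.
  by rewrite /a; case: cid2 => // b Ab; exact.
have [p hp] := bernstein_poly N (fun k => f (a k)).
exists (p \Po (L^-1 *: 'X)) => t At.
have /andP[t0 tL] := AL _ At.
rewrite horner_comp hornerZ hornerX hp; set y := L^-1 * t.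
have tE : t = L * y by rewrite /y mulVKf ?gt_eqF.
have y01 : 0 <= y <= 1.
  by rewrite /y mulr_ge0 ?invr_ge0 ?(ltW L0)//= mulrC ler_pdivrMr// mul1r.
have Nn0 : N%:R != 0 :> R by rewrite pnatr_eq0.
(* As [t] itself lies in [A], the sample point satisfies [|t - a k| <= 2 d + eta], with [d] the
   distance from [t] to the node; then [(2 d + eta)^2 <= 8 d^2 + 2 eta^2]. *)
pose G k : R := (e / 4 + 2 * K * eta ^+ 2) + (8 * K * L ^+ 2 / N%:R ^+ 2) * (k%:R - N%:R * y) ^+ 2.
have bd k : `|f t - f (a k)| <= G k.
  rewrite (le_trans (hK _ _ At (Aa k)))// /G -addrA lerD2l.
  have : `|t - a k| <= 2 * `|t - L * (k%:R / N%:R)| + eta.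
    have := aP k t At; have := ler_distD (L * (k%:R / N%:R)) t (a k).
    by rewrite [X in _ <= _ + X -> _]distrC; lra.
  set d := `|t - L * _| => h.
  have h2 : (t - a k) ^+ 2 <= 8 * d ^+ 2 + 2 * eta ^+ 2.
    rewrite -[leLHS]real_normK ?num_real//.
    have : `|t - a k| ^+ 2 <= (2 * d + eta) ^+ 2.
      have dd : 0 <= d by exact: normr_ge0.
      by rewrite ler_pXn2r ?nnegrE// addr_ge0 ?(ltW eta0)// mulr_ge0.
    have := sqr_ge0 (2 * d - eta); nra.
  have d2 : d ^+ 2 = L ^+ 2 / N%:R ^+ 2 * (k%:R - N%:R * y) ^+ 2.
    by rewrite /d real_normK ?num_real// tE; field.
  have := ler_wpM2l K0 h2; rewrite d2; set W := (_ - _) ^+ 2; set Q := _ / _.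
  have -> : 8 * K * L ^+ 2 / N%:R ^+ 2 = 8 * K * Q by rewrite /Q !mulrA.
  by nra.
have -> : f t - bernstein N y (fun k => f (a k)) =
    bernstein N y (fun k => f t - f (a k)).
  rewrite bernsteinD bernstein_cst; congr (_ + _).
  rewrite -mulN1r -bernsteinZ; by apply: eq_bernstein => k; rewrite mulN1r.
have main : bernstein N y G <= e.
  rewrite bernsteinD bernstein_cst bernsteinZ bernstein_variance.
  have y1 : y * (1 - y) <= 1 by case/andP: y01; nra.
  have -> : 8 * K * L ^+ 2 / N%:R ^+ 2 * (N%:R * (y * (1 - y))) =
    K * (8 * (L ^+ 2 / N%:R)) * (y * (1 - y)) by field.
  have P0 : 0 <= K * (8 * (L ^+ 2 / N%:R)).
    by rewrite mulr_ge0// mulr_ge0// divr_ge0 ?sqr_ge0.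
  have := ler_wpM2l P0 y1; lra.
rewrite ler_norml; apply/andP; split; last first.
  apply: le_trans main; apply: ler_bernstein => // k.
  by have := bd k; rewrite ler_norml => /andP[].
rewrite (@le_trans _ _ (bernstein N y (fun k => (-1) * G k)))//.
  by rewrite bernsteinZ mulN1r lerN2.
apply: ler_bernstein => // k; rewrite mulN1r.
by have := bd k; rewrite ler_norml => /andP[].
Qed.

(** A quadratic modulus is what the binomial variance can average. Choose [d] with [c d^al <= e]; at
    distance [r > d], [(r / d)^al <= (r / d)^2]. *)
Lemma holder_modulus (A : set R) (f : R -> R) (al c : R) : 0 < al < 1 -> 0 <= c ->
  (forall s t, A s -> A t -> `|f s - f t| <= c * powR `|s - t| al) ->
  forall e, 0 < e -> exists2 K, 0 <= K & forall s t, A s -> A t ->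
     `|f s - f t| <= e + K * (s - t) ^+ 2.
Proof.
move=> /andP[al0 al1] c0 hc e e0.
have c1 : 0 < c + 1 by rewrite ltr_pwDr.
pose d := powR (e / (c + 1)) al^-1.
have ec : 0 < e / (c + 1) by rewrite divr_gt0.
have d0 : 0 < d by rewrite powR_gt0.
have dal : powR d al = e / (c + 1) by rewrite -powRrM mulVf ?gt_eqF// powRr1// ltW.
exists (c * (powR d al / d ^+ 2)) => [|s t As At].
  by rewrite mulr_ge0// divr_ge0 ?powR_ge0// sqr_ge0.
rewrite (le_trans (hc _ _ As At))// -[(s - t) ^+ 2]real_normK ?num_real//.
move: `|s - t| (normr_ge0 (s - t)) => r r0.
have [rd|dr] := leP r d.
  rewrite ler_wpDr//; first by rewrite mulr_ge0 ?sqr_ge0// mulr_ge0// divr_ge0 ?powR_ge0 ?sqr_ge0.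
  apply: (@le_trans _ _ (c * powR d al)).
    by rewrite ler_wpM2l// ge0_ler_powR ?nnegrE// ltW.
  by rewrite dal mulrCA ler_piMr ?(ltW e0)// ler_pdivrMr// mul1r lerDl.
rewrite ler_wpDl ?(ltW e0)// -mulrA ler_wpM2l//.
have r1 : 0 < r by exact: lt_trans dr.
have -> : powR r al = powR d al * powR (r / d) al.
  by rewrite -powRM ?divr_ge0 ?(ltW d0)// mulrCA divff ?gt_eqF// mulr1.
rewrite -mulrA ler_wpM2l ?powR_ge0//.
have -> : d ^- 2 * r ^+ 2 = (r / d) ^+ 2 by rewrite expr_div_n mulrC.
have rd1 : 1 <= r / d by rewrite ler_pdivlMr// mul1r ltW.
by rewrite -powR_mulrn ?(le_trans _ rd1)// ler_powR//; lra.
Qed.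

End Weierstrass.

(** * Finite sums of integrals and a limit argument *)

Section RealIntegral.
Variable R : realType.

Lemma itg_sum (a b : R) N (f : nat -> R -> R) : (forall i, continuous (f i)) ->
  itg a b (fun s => \sum_(i < N) f i s) = \sum_(i < N) itg a b (f i).
Proof.
move=> cf.
have cs k : continuous (fun s => \sum_(i < k) f i s).
  elim: k => [|k IH] x; first by under eq_fun do rewrite big_ord0; exact: cst_continuous.
  by under eq_fun do rewrite big_ord_recr/=; apply: cvgD; [exact: IH|exact: cf].
elim: N => [|N IH].
  rewrite big_ord0; under eq_fun do rewrite big_ord0.
  have := @itgZ R a b 0 (fun=> 0) (@cst_continuous _ _ _).
  by under eq_fun do rewrite mul0r; rewrite mul0r.
rewrite big_ord_recr/= -IH -itgD//.
by congr itg; apply/funext => s; rewrite big_ord_recr.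
Qed.

Lemma le0_limit (a K : R) : (forall r, 0 < r <= 1 -> a <= K * r) -> a <= 0.
Proof.
move=> h; rewrite leNgt; apply/negP => a0.
have K0 : 0 < K.
  by have := h 1; rewrite ltr01 lexx mulr1 => /(_ isT); exact: lt_le_trans.
have r0 : 0 < Num.min 1 (a / (2 * K)).
  by rewrite lt_min ltr01 divr_gt0// mulr_gt0.
have := h _; move=> /(_ (Num.min 1 (a / (2 * K)))); rewrite r0 ge_min lexx => /(_ isT) h1.
have : K * Num.min 1 (a / (2 * K)) <= K * (a / (2 * K)).
  by rewrite ler_pM2l// ge_min lexx orbT.
have -> : K * (a / (2 * K)) = a / 2 by field; rewrite gt_eqF.
lra.
Qed.

End RealIntegral.

(** * The Cauchy transform to the left of the support *)

Section RealPart.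
Variables (R : realType) (n : nat).
Hypothesis n0 : (0 < n)%N.
Local Open Scope complex_scope.
Notation C := (Cplx R).
Notation B := (@cardinal_bspline R n.+1).
Notation F := (@bspline_cauchy R n).
Notation m := (n.+1%:R : R).

(** Integrating the truncated powers up to [m] leaves the difference of order [n + 1] of
    [y^(n+1) / (n+1)!]. The value 1 is the leading coefficient of every [bspline_moment]. *)
Lemma itg_bspline : itg 0 m B = 1.
Proof.
pose c j : R := (-1) ^+ j * 'C(n.+1, j)%:R.
have ct (j : nat) : continuous (fun s : R => tpow n (s - j%:R)).
  move=> s; apply: (@continuous_comp R R R (fun y : R => y - j%:R) (tpow n)); last exact: continuous_tpow.
  by apply: cvgB; [exact: cvg_id|exact: cst_continuous].
pose f (j : nat) (s : R) : R := c j * tpow n (s - j%:R).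
have cf j : continuous (f j).
  by move=> s; apply: cvgM; [exact: cst_continuous|exact: ct].
have cs : continuous (fun s => \sum_(j < n.+2) f j s).
  elim: (n.+2) => [|k IH] x; first by under eq_fun do rewrite big_ord0; exact: cst_continuous.
  by under eq_fun do rewrite big_ord_recr/=; apply: cvgD; [exact: IH|exact: cf].
have -> : itg 0 m B = n`!%:R^-1 * itg 0 m (fun s => \sum_(j < n.+2) f j s).
  by rewrite -itgZ.
rewrite itg_sum//.
have E (j : 'I_n.+2) : itg 0 m (f j) = n.+1%:R^-1 * (c j * (m - j%:R) ^+ n.+1).
  have jn : j%:R <= m by rewrite ler_nat -ltnS.
  rewrite itgZ// mulrCA; congr (_ * _).
  rewrite mulrC -itg_pow//; transitivity (itg j%:R m (fun s : R => tpow n (s - j%:R))).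
    have sub : [set` `[j%:R : R, m]] `<=` `[0, m].
      by apply: subset_itvr; rewrite bnd_simp.
    apply: itg_support => // s; rewrite /= in_itv/= => /andP[_ sn].
    by rewrite sn andbT -ltNge => /ltW sj; rewrite tpow_le0 ?subr_le0.
  by apply: itg_eq => s /andP[js _]; rewrite tpow_ge0 ?subr_ge0.
under eq_bigr do rewrite E.
rewrite -mulr_sumr; have := @bdiff_exp R n.+1 n.+1 m (leqnn _).
rewrite /bdiff eqxx => ->; rewrite factS natrM mulKf ?pnatr_eq0//.
by rewrite mulVf// pnatr_eq0 -lt0n fact_gt0.
Qed.

(* [max s 0] equals [s] on the support of [B] and makes the integrand
   continuous on the whole line. *)
Definition cauchy_left (u : R) : R := itg 0 m (fun s => B s * (Num.max s 0 + u)^-1).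

Lemma continuous_max0D (u : R) : continuous (fun s : R => Num.max s 0 + u).
Proof.
move=> s; apply: cvgD; last exact: cst_continuous.
by apply: (@continuous_max R R id (cst 0)); [exact: cvg_id|exact: cst_continuous].
Qed.

Lemma max0D_gt0 (s u : R) : 0 < u -> 0 < Num.max s 0 + u.
Proof. by move=> u0; rewrite ltr_wpDl// le_max lexx orbT. Qed.

Lemma continuous_invD (u : R) : 0 < u -> continuous (fun s : R => (Num.max s 0 + u)^-1).
Proof.
by move=> u0 s; apply: cvgV; [rewrite gt_eqF// max0D_gt0|exact: continuous_max0D].
Qed.

(** The integral formula is known only above the axis, so [-u] is approached from height [r^2]. With
    Hölder exponent 1/2 this costs [c r], and the integrals also differ by [O(r)] since the kernel
    stays at distance [u] from its pole. *)
Lemma Re_bspline_cauchy (u : R) : 0 < u ->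
  complex.Re (F (- u)%:C) = cauchy_left u.
Proof.
move=> u0; have cB := @continuous_bspline R n.
have [K K0 BK] := @bspline_bounded R n n0.
have half01 : 0 < (2^-1 : R) < 1 by apply/andP; split; lra.
have r0 : 0 < u + 1 by rewrite addr_gt0.
have [c c0 hc] := holder_const (holder_bspline_cauchy n0 half01) r0.
suff : `|complex.Re (F (- u)%:C) - cauchy_left u| <= 0.
  by rewrite normr_le0 subr_eq0 => /eqP.
apply: (@le0_limit _ _ (c + K * (u ^+ 3)^-1 * m)) => r /andP[rr0 r1].
pose z : C := - u +i* (r ^+ 2).
have y0 : 0 < r ^+ 2 by rewrite exprn_gt0.
have y1 : r ^+ 2 <= 1 by rewrite expr_le1// ltW.
have hz : UHP z by [].
have d1 : `|complex.Re (F (- u)%:C) - complex.Re (F z)| <= c * r.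
  have -> : complex.Re (F (- u)%:C) - complex.Re (F z) = complex.Re (F (- u)%:C - F z).
    by rewrite ReD ReN.
  rewrite (le_trans (Re_le_cabs _))//.
  rewrite (le_trans (hc _ _ _ _ _ _))//.
  - by rewrite /UHPc/=.
  - by rewrite /UHPc/= ltW.
  - by rewrite cabs_real normrN gtr0_norm// lerDl.
  - by rewrite (le_trans (cabs_le _))//= normrN !gtr0_norm// lerD2l.
  have -> : cabs ((- u)%:C - z) = r ^+ 2.
    by rewrite cabsE /= subrr sub0r sqrrN expr0n add0r sqrtr_sqr gtr0_norm.
  by rewrite -powR_mulrn ?(ltW rr0)// -powRrM divff// powRr1// ltW.
have d2 : `|complex.Re (F z) - cauchy_left u| <= K * (u ^+ 3)^-1 * m * r.
  rewrite bspline_cauchyE//.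
  have -> : complex.Re (citg 0 m (fun s => (B s)%:C * (s%:C - z)^-1)) =
      itg 0 m (fun s => B s * complex.Re (s%:C - z)^-1).
    by apply: itg_eq => s _; rewrite ReM/= mul0r subr0.
  have [cr _] := ccontinuous_inv_sub hz.
  have c1 : continuous (fun s => B s * complex.Re (s%:C - z)^-1).
    by move=> s; apply: cvgM; [exact: cB|exact: cr].
  have c2 : continuous (fun s => - (B s * (Num.max s 0 + u)^-1)).
    by move=> s; apply: cvgN; apply: cvgM; [exact: cB|exact: continuous_invD].
  rewrite -itgN; last by move=> s; apply: cvgM; [exact: cB|exact: continuous_invD].
  rewrite -itgD//.
  have -> : K * (u ^+ 3)^-1 * m * r = K * (u ^+ 3)^-1 * r * (m - 0) by rewrite subr0; ring.
  apply: itg_bound => // [|s /andP[s0 _]].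
    by move=> s; apply: cvgD; [exact: c1|exact: c2].
  rewrite max_l// Re_inv_sub/= -mulrBr normrM -mulrA ler_pM//.
  set v := s + u; have v0 : 0 < v by rewrite ltr_wpDl.
  have uv : u <= v by rewrite lerDr.
  have -> : - (- u - s) = v by rewrite /v; ring.
  have -> : (- u - s) ^+ 2 = v ^+ 2 by rewrite /v; ring.
  have -> : v / (v ^+ 2 + r ^+ 2 ^+ 2) - v^-1 = - (r ^+ 4 / (v * (v ^+ 2 + r ^+ 4))).
    have : v ^+ 2 + r ^+ 4 != 0 by rewrite gt_eqF// addr_gt0// exprn_gt0.
    by move=> h; rewrite -exprM; field; rewrite h gt_eqF.
  have D0 : 0 < v * (v ^+ 2 + r ^+ 4) by rewrite mulr_gt0// addr_gt0// exprn_gt0.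
  rewrite normrN ger0_norm ?divr_ge0 ?(ltW D0)// ?exprn_ge0 ?(ltW rr0)//.
  rewrite mulrC ler_pM ?invr_ge0 ?(ltW D0) ?exprn_ge0 ?(ltW rr0)//.
    rewrite lef_pV2 ?posrE ?exprn_gt0// exprS ler_pM ?(ltW u0) ?sqr_ge0//.
    by rewrite ler_wpDr ?exprn_ge0 ?(ltW rr0)// ler_pXn2r ?nnegrE ?(ltW u0) ?(ltW v0).
  by rewrite exprS ler_piMr ?(ltW rr0)// exprn_ile1 ?(ltW rr0).
have := ler_distD (complex.Re (F z)) (complex.Re (F (- u)%:C)) (cauchy_left u).
by lra.
Qed.

(** The coefficient of [k^-(j+1)] in the expansion of [cauchy_left (k - t)]. *)
Definition bspline_moment (j : nat) (t : R) : R := itg 0 m (fun s => B s * (t - s) ^+ j).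

Lemma continuous_bspline_pow (j : nat) (t : R) : continuous (fun s => B s * (t - s) ^+ j).
Proof.
move=> s; apply: cvgM; first exact: continuous_bspline.
apply: (@continuous_comp R R R (fun y : R => t - y) (fun y => y ^+ j)); last exact: exprn_continuous.
by apply: cvgB; [exact: cst_continuous|exact: cvg_id].
Qed.

Lemma bspline_momentE (j : nat) (t : R) : bspline_moment j t =
  \sum_(i < j.+1) ('C(j, i)%:R * itg 0 m (fun s => B s * (- s) ^+ i)) * t ^+ (j - i).
Proof.
pose f i (s : R) : R := ('C(j, i)%:R * t ^+ (j - i)) * (B s * (- s) ^+ i).
have cp i : continuous (fun s => B s * (- s) ^+ i).
  by move=> s; have := @continuous_bspline_pow i 0 s; under eq_fun do rewrite sub0r.
have cf i : continuous (f i).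
  by move=> s; apply: cvgM; [exact: cst_continuous|exact: cp].
transitivity (itg 0 m (fun s => \sum_(i < j.+1) f i s)).
  apply: itg_eq => s _; rewrite exprDn mulr_sumr; apply: eq_bigr => i _.
  by rewrite /f -mulr_natr; ring.
rewrite itg_sum//; apply: eq_bigr => i _; rewrite itgZ//; ring.
Qed.

(* Geometric expansion of [1 / (k - (t - s))] in powers of [1 / k]. *)
Lemma cauchy_left_expansion (L : R) (j : nat) : 0 <= L -> exists2 C, 0 <= C &
  forall (k t : R), L < k -> 0 <= t <= L ->
  `|k ^+ j.+1 * (cauchy_left (k - t) - \sum_(i < j) bspline_moment i t / k ^+ i.+1)
    - bspline_moment j t| <= C / (k - L).
Proof.
move=> L0; have [K K0 BK] := @bspline_bounded R n n0.
have cB := @continuous_bspline R n.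
(* In the remainder [|B| <= K], [|t - s| <= L + m], the denominator is at least [k - L], and the
   segment has length [m]. *)
exists (K * (L + m) ^+ j.+1 * m) => [|k t Lk /andP[t0 tL]].
  by rewrite !mulr_ge0// exprn_ge0// addr_ge0.
have k0 : 0 < k by exact: le_lt_trans Lk.
have u0 : 0 < k - t by rewrite subr_gt0 (le_lt_trans tL).
have kL : 0 < k - L by rewrite subr_gt0.
pose f i (s : R) : R := (k ^+ i.+1)^-1 * (B s * (t - s) ^+ i).
have cf i : continuous (f i).
  by move=> s; apply: cvgM; [exact: cst_continuous|exact: continuous_bspline_pow].
pose r (s : R) : R := B s * (t - s) ^+ j.+1 * (Num.max s 0 + (k - t))^-1.
have cr : continuous r.
  by move=> s; apply: cvgM; [exact: continuous_bspline_pow|exact: continuous_invD].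
have geo (q v : R) N : q != 0 -> q - v != 0 ->
    (q - v)^-1 = \sum_(i < N) (q ^+ i.+1)^-1 * v ^+ i + (q ^+ N)^-1 * (v ^+ N * (q - v)^-1).
  move=> q0 qv; elim: N => [|N IH]; first by rewrite big_ord0 !expr0 invr1 !mul1r add0r.
  rewrite big_ord_recr/= [LHS]IH -addrA; congr (_ + _).
  rewrite !exprS; have : q ^+ N != 0 by rewrite expf_neq0.
  by move=> qN; field; rewrite q0 qN qv.
have cs N : continuous (fun s => \sum_(i < N) f i s).
  elim: N => [|N IH] x; first by under eq_fun do rewrite big_ord0; exact: cst_continuous.
  by under eq_fun do rewrite big_ord_recr/=; apply: cvgD; [exact: IH|exact: cf].
have -> : cauchy_left (k - t) =
    \sum_(i < j.+1) bspline_moment i t / k ^+ i.+1 + (k ^+ j.+1)^-1 * itg 0 m r.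
  transitivity (itg 0 m (fun s => \sum_(i < j.+1) f i s + (k ^+ j.+1)^-1 * r s)).
    apply: itg_eq => s /andP[s0 _].
    have E : Num.max s 0 + (k - t) = k - (t - s) by rewrite max_l//; ring.
    have v0 : 0 < k - (t - s) by rewrite -E max0D_gt0.
    rewrite /r E [X in B s * X = _](geo k (t - s) j.+1) ?gt_eqF// mulrDr mulr_sumr; congr (_ + _).
      by apply: eq_bigr => i _; rewrite /f; ring.
    by ring.
  have ckr : continuous (fun s => (k ^+ j.+1)^-1 * r s).
    by move=> s; apply: cvgM; [exact: cst_continuous|exact: cr].
  rewrite itgD// itgZ// itg_sum//; congr (_ + _); apply: eq_bigr => i _.
  by rewrite [LHS]itgZ; [exact: mulrC|exact: continuous_bspline_pow].
rewrite big_ord_recr/=.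
set S := \sum_(i < j) _; set P := bspline_moment j t.
have -> : k ^+ j.+1 * (S + P / k ^+ j.+1 + (k ^+ j.+1)^-1 * itg 0 m r - S) - P = itg 0 m r.
  have : k ^+ j.+1 != 0 by rewrite expf_neq0// gt_eqF.
  by move: (k ^+ j.+1) => q q0; field.
rewrite -[X in _ * X / _](subr0 m) mulrAC; apply: itg_bound => // s /andP[s0 sm].
rewrite /r normrM [X in X * _ <= _]normrM ler_pM ?mulr_ge0// ?ler_pM//.
  rewrite normrX ler_pXn2r ?nnegrE ?addr_ge0// ler_norml; apply/andP; split; lra.
rewrite normfV gtr0_norm ?max0D_gt0// lef_pV2 ?posrE ?max0D_gt0// max_l//; lra.
Qed.

End RealPart.

(** * Uniform closure of a span of functions *)

Section UniformSpan.
Variables (R : realType) (G : nat -> R -> R) (K0 : nat) (T : set R).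
Implicit Types (f g : R -> R).

(** Coefficients form a sequence that is zero outside [[K0, N)]: expansions of different lengths can
    be added after padding, and generators before [K0] stay excluded. *)
Definition uniform_span f := forall e, 0 < e -> exists (N : nat) (d : nat -> R),
  (forall k, (k < K0)%N || (N <= k)%N -> d k = 0) /\
  forall t, T t -> `|f t - \sum_(k < N) d k * G k t| <= e.

Lemma sum_pad (N N' : nat) (d f : nat -> R) : (N <= N')%N ->
  (forall k, (N <= k)%N -> d k = 0) ->
  \sum_(k < N') d k * f k = \sum_(k < N) d k * f k.
Proof.
move=> NN d0; rewrite (big_ord_widen _ (fun k => d k * f k) NN) [RHS]big_mkcond/=.
by apply: eq_bigr => k _; case: ltnP => // /d0 ->; rewrite mul0r.
Qed.

Lemma uniform_span_ext f g : (forall t, T t -> f t = g t) ->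
  uniform_span f -> uniform_span g.
Proof.
move=> fg hf e e0; have [N [d [d0 hd]]] := hf e e0.
by exists N, d; split => // t Tt; rewrite -fg// hd.
Qed.

Lemma uniform_span_lim f : (forall e, 0 < e -> exists2 g, uniform_span g &
    forall t, T t -> `|f t - g t| <= e) -> uniform_span f.
Proof.
move=> hf e e0; have e2 : 0 < e / 2 by rewrite divr_gt0.
have [g hg fg] := hf _ e2; have [N [d [d0 hd]]] := hg _ e2.
exists N, d; split => // t Tt; rewrite (le_trans (ler_distD (g t) _ _))//.
by rewrite [leRHS]splitr lerD ?fg ?hd.
Qed.

Lemma uniform_spanD f g : uniform_span f -> uniform_span g ->
  uniform_span (fun t => f t + g t).
Proof.
move=> hf hg e e0; have e2 : 0 < e / 2 by rewrite divr_gt0.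
have [N [d [d0 hd]]] := hf _ e2; have [N' [d' [d'0 hd']]] := hg _ e2.
exists (maxn N N'), (fun k => d k + d' k); split => [k|t Tt].
  by rewrite geq_max => hk; rewrite d0 ?d'0 ?addr0//; lia.
have -> : \sum_(k < maxn N N') (d k + d' k) * G k t =
    \sum_(k < N) d k * G k t + \sum_(k < N') d' k * G k t.
  rewrite -(@sum_pad N (maxn N N') d (fun k => G k t)) ?leq_maxl//; last first.
    by move=> k hk; rewrite d0// hk orbT.
  rewrite -(@sum_pad N' (maxn N N') d' (fun k => G k t)) ?leq_maxr//; last first.
    by move=> k hk; rewrite d'0// hk orbT.
  by rewrite -big_split; apply: eq_bigr => k _; rewrite mulrDl.
rewrite opprD addrACA (le_trans (ler_normD _ _))// [leRHS]splitr.
by rewrite lerD ?hd ?hd'.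
Qed.

Lemma uniform_spanZ a f : uniform_span f -> uniform_span (fun t => a * f t).
Proof.
move=> hf e e0; have a1 : 0 < `|a| + 1 by rewrite ltr_pwDr.
have [N [d [d0 hd]]] := hf _ (divr_gt0 e0 a1).
exists N, (fun k => a * d k); split => [k /d0 ->|t Tt]; first by rewrite mulr0.
under eq_bigr do rewrite -mulrA.
rewrite -mulr_sumr -mulrBr normrM.
have := hd t Tt; rewrite ler_pdivlMr//; move: `|_ - _| (normr_ge0 (f t - \sum_(k < N) d k * G k t)) => r r0.
by have := normr_ge0 a; nra.
Qed.

Lemma uniform_span0 : uniform_span (fun=> 0).
Proof.
move=> e e0; exists 0%N, (fun=> 0); split => // t _.
by rewrite big_ord0 subr0 normr0 ltW.
Qed.

Lemma uniform_span_sum N (f : nat -> R -> R) :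
  (forall i, (i < N)%N -> uniform_span (f i)) ->
  uniform_span (fun t => \sum_(i < N) f i t).
Proof.
elim: N => [|N IH] hf.
  by apply: uniform_span_ext uniform_span0 => t _; rewrite big_ord0.
have h : uniform_span (fun t => \sum_(i < N) f i t + f N t).
  by apply: uniform_spanD; [apply: IH => i iN; apply: hf; exact: ltnW|exact: hf].
by apply: uniform_span_ext h => t _; rewrite big_ord_recr.
Qed.

Lemma uniform_span_gen k : (K0 <= k)%N -> uniform_span (G k).
Proof.
move=> kK e e0; exists k.+1, (fun i => (i == k)%:R); split => [i hi|t _].
  by case: eqP => // ik; move: hi; rewrite ik; lia.
rewrite big_ord_recr/= eqxx mul1r big1 ?add0r ?subrr ?normr0 ?ltW// => i _.
by rewrite ltn_eqF ?mul0r.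
Qed.

Lemma uniform_span_poly (p : {poly R}) :
  (forall i, uniform_span (fun t => t ^+ i)) -> uniform_span (fun t => p.[t]).
Proof.
move=> h; have hs : uniform_span (fun t => \sum_(i < size p) p`_i * t ^+ i).
  by apply: (@uniform_span_sum _ (fun i t => p`_i * t ^+ i)) => i _; exact: uniform_spanZ.
by apply: uniform_span_ext hs => t _; rewrite horner_coef.
Qed.

End UniformSpan.

(** * Approximation of the real part, then of the imaginary part *)

Section Density.
Variables (R : realType) (n : nat).
Hypothesis n0 : (0 < n)%N.
Local Open Scope complex_scope.
Notation C := (Cplx R).
Notation B := (@cardinal_bspline R n.+1).
Notation F := (@bspline_cauchy R n).
Notation m := (n.+1%:R : R).

Definition shifted_cauchy (k : nat) (t : R) : R := complex.Re (F (t - k%:R)%:C).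

Section Interval.
Variables (K0 : nat) (L : R).
Hypothesis L0 : 0 <= L.
Notation T := [set t : R | 0 <= t <= L].

(* Letting k tend to infinity in the expansion of the k-th translate extracts
   the successive coefficients of 1 / k. *)
Lemma uniform_span_moment j : uniform_span shifted_cauchy K0 T (bspline_moment n j).
Proof.
elim/ltn_ind: j => j IH; apply: uniform_span_lim => e e0.
have [c c0 hc] := cauchy_left_expansion n0 j L0.
(* Large enough to be an admissible index and to make the remainder [c / (k - L)] at most [e]. *)
pose k := (K0 + (Num.bound (L + c / e)).+1)%N.
have kb : L + c / e < k%:R.
  rewrite (lt_le_trans (archi_boundP _))//; first by rewrite addr_ge0// divr_ge0// ltW.
  by rewrite ler_nat /k; lia.
have Lk : L < k%:R by rewrite (le_lt_trans _ kb)// lerDl divr_ge0// ltW.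
exists (fun t => k%:R ^+ j.+1 * (shifted_cauchy k t +
    (-1) * \sum_(i < j) (k%:R ^+ i.+1)^-1 * bspline_moment n i t)).
  apply: uniform_spanZ; apply: uniform_spanD; first by apply: uniform_span_gen; rewrite /k leq_addr.
  apply: uniform_spanZ.
  apply: (@uniform_span_sum _ _ _ _ _ (fun i t => (k%:R ^+ i.+1)^-1 * bspline_moment n i t)) => i ij.
  by apply: uniform_spanZ; exact: IH.
move=> t /= Tt; have /andP[t0 tL] := Tt.
have -> : shifted_cauchy k t = cauchy_left n (k%:R - t).
  by rewrite -Re_bspline_cauchy ?opprB// subr_gt0 (le_lt_trans tL).
rewrite mulN1r distrC; under eq_bigr do rewrite mulrC.
rewrite (le_trans (hc _ _ Lk Tt))// ler_pdivrMr ?subr_gt0//.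
have : c / e <= k%:R - L by lra.
by rewrite ler_pdivrMr// mulrC.
Qed.

(** The moments form a triangular system in the powers of [t] with unit diagonal, solved by
    induction on [j]. *)
Lemma uniform_span_exp j : uniform_span shifted_cauchy K0 T (fun t => t ^+ j).
Proof.
elim/ltn_ind: j => j IH.
pose a i : R := 'C(j, i)%:R * itg 0 m (fun s => B s * (- s) ^+ i).
have h : uniform_span shifted_cauchy K0 T (fun t => bspline_moment n j t +
    (-1) * \sum_(i < j) a i.+1 * t ^+ (j - i.+1)).
  apply: uniform_spanD; first exact: uniform_span_moment.
  apply: uniform_spanZ.
  apply: (@uniform_span_sum _ _ _ _ _ (fun i t => a i.+1 * t ^+ (j - i.+1))) => i ij.
  by apply: uniform_spanZ; apply: IH; lia.
apply: uniform_span_ext h => t _.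
rewrite bspline_momentE// big_ord_recl/= subn0 bin0.
have -> : itg 0 m (fun s => B s * (- s) ^+ 0) = 1.
  by rewrite -[RHS](itg_bspline R n0); apply: itg_eq => s _; rewrite expr0 mulr1.
by rewrite !mul1r mulN1r addrK.
Qed.

End Interval.

Lemma shifted_cauchy_dense (K0 : nat) (L : R) (A : set R) (f : R -> R) : 0 < L ->
  (forall t, A t -> 0 <= t <= L) ->
  (forall e, 0 < e -> exists2 K, 0 <= K & forall s t, A s -> A t ->
     `|f s - f t| <= e + K * (s - t) ^+ 2) ->
  uniform_span shifted_cauchy K0 A f.
Proof.
move=> L0 AL hf; apply: uniform_span_lim => e e0.
have [p hp] := weierstrass L0 AL hf e0.
exists (fun t => p.[t]) => //.
move=> d d0.
have [N [c [c0 hc]]] := @uniform_span_poly _ _ _ _ p (@uniform_span_exp K0 L (ltW L0)) d d0.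
by exists N, c; split => // t /AL; exact: hc.
Qed.

Lemma sum_window (N a b : nat) : (\sum_(k < N) (a <= k < b) <= minn N b - a)%N.
Proof.
elim: N => [|N IH]; first by rewrite big_ord0.
rewrite big_ord_recr/=; move: IH; set s := (\sum_(i < N) _)%N.
by case: leqP; case: ltnP => /=; lia.
Qed.

(** With [T] the integer part of [t], only the indices from [T - n] to [T] can be active, at most
    [m] of them. *)
Lemma bspline_window (N : nat) (t e : R) (g : nat -> R) : 0 <= t -> 0 <= e ->
  (forall k, 0 < t - k%:R < m -> `|g k| <= e) ->
  (forall k, ~~ (0 < t - k%:R < m) -> g k = 0) ->
  \sum_(k < N) `|g k| <= m * e.
Proof.
move=> t0 e0 hg g0; set T := Num.truncn t.
have /andP[Tt tT] := truncn_itv t0.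
have bd k : `|g k| <= (T - n <= k < T.+1)%N%:R * e.
  have [hk|hk] := boolP (0 < t - k%:R < m); last first.
    by rewrite g0// normr0 mulr_ge0.
  suff -> : (T - n <= k < T.+1)%N by rewrite mul1r hg.
  have /andP[h1 h2] := hk.
  have kT : (k < T.+1)%N by rewrite -(ltr_nat R); lra.
  have Tk : (T < k + n.+1)%N by rewrite -(ltr_nat R) natrD; rewrite -/T in Tt; lra.
  by rewrite kT andbT; lia.
rewrite (le_trans (ler_sum _ (fun (k : 'I_N) _ => bd k)))// -mulr_suml ler_wpM2r//.
rewrite -natr_sum ler_nat (leq_trans (sum_window _ _ _))//; lia.
Qed.

(** Quasi-interpolation: each coefficient samples [v] at a point of [Om] inside the support of its
    B-spline. By the partition of unity the error at [x] averages differences of [v] over distances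
    below [h m]; the factor [pi^-1] offsets [Im F = pi B]. *)
Lemma spline_dense (Om : set R) (v : R -> R) (M al c del : R) : 0 < al < 1 ->
  0 <= M -> 0 <= c -> 0 < del -> (forall x, Om x -> `|x| <= M) ->
  (forall x y, Om x -> Om y -> `|v x - v y| <= c * powR `|x - y| al) ->
  exists (x0 h : R) (N : nat) (cf : nat -> R), 0 < h /\ forall x, Om x ->
    n%:R <= (x - x0) / h <= N%:R /\ `|v x - pi * spline n x0 h N cf x| <= del.
Proof.
move=> /andP[al0 al1] M0 c0 del0 OM hv.
have [K K0 BK] := @bspline_bounded R n n0.
have m0 : 0 < m by rewrite ltr0n.
(* At most [m] B-splines are active, each bounded by [K], against an oscillation [c rho^al]; [rho]
   brings the product below [del]. *)
pose D := m * (c * K).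
have D0 : 0 <= D by rewrite !mulr_ge0.
have D1 : 0 < D + 1 by rewrite ltr_pwDr.
pose rho := powR (del / (D + 1)) al^-1.
have dD : 0 < del / (D + 1) by rewrite divr_gt0.
have rho0 : 0 < rho by rewrite powR_gt0.
have rhoal : powR rho al = del / (D + 1).
  by rewrite -powRrM mulVf ?gt_eqF// powRr1// ltW.
pose h := rho / m; have h0 : 0 < h by rewrite divr_gt0.
(* Starting [n] cells to the left of [-M] places [Om] where the translates sum to 1. *)
pose x0 := - M - h * n%:R.
pose N := Num.bound (2 * M / h + n%:R).
pose P k x := Om x /\ 0 < (x - x0) / h - k%:R < m.
(* The default 0 occurs only when the open support misses [Om], so that the coefficient is never
   seen there. *)
pose tau k := if pselect (exists x, P k x) is left e then sval (cid e) else 0.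
have tauP k x : P k x -> P k (tau k).
  move=> Px; rewrite /tau; case: pselect => [e|ne]; first by case: cid.
  by exfalso; apply: ne; exists x.
exists x0, h, N, (fun k => pi^-1 * v (tau k)); split => // x Ox.
have /andP[Mx xM] : - M <= x <= M by rewrite -ler_norml; exact: OM.
have tE : (x - x0) / h = (x + M) / h + n%:R.
  by rewrite /x0; field; rewrite gt_eqF.
set t := (x - x0) / h in tE *.
have nt : n%:R <= t by rewrite tE lerDr divr_ge0 ?(ltW h0)//; lra.
have tN : t <= N%:R.
  have : 2 * M / h + n%:R <= N%:R.
    by apply/ltW/archi_boundP; rewrite addr_ge0// divr_ge0 ?(ltW h0)// mulr_ge0.
  apply: le_trans; rewrite tE lerD2r ler_pM2r ?invr_gt0//; lra.
split; first by rewrite nt tN.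
have part := @bspline_partition_unity R n n0 N t; rewrite nt tN in part.
have pi0 : pi != 0 :> R by rewrite gt_eqF// pi_gt0.
have -> : v x - pi * spline n x0 h N (fun k => pi^-1 * v (tau k)) x =
    \sum_(k < N) (v x - v (tau k)) * B (t - k%:R).
  under [RHS]eq_bigr do rewrite mulrBl.
  rewrite sumrB -mulr_sumr part// mulr1; congr (_ - _).
  by rewrite mulr_sumr; apply: eq_bigr => k _; rewrite !mulrA divff// mul1r.
rewrite (le_trans (ler_norm_sum _ _ _))//.
have e0 : 0 <= c * (del / (D + 1)) * K by rewrite mulr_ge0// mulr_ge0// ltW.
have t0 : 0 <= t by rewrite (le_trans _ nt).
rewrite (le_trans (bspline_window N t0 e0 (g := fun k => (v x - v (tau k)) * B (t - k%:R)) _ _))//.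
- move=> k hk; rewrite normrM ler_pM//.
  have [Ot ht] := tauP k x (conj Ox hk).
  rewrite (le_trans (hv _ _ Ox Ot))// ler_wpM2l// -rhoal.
  rewrite ge0_ler_powR ?nnegrE ?(ltW al0) ?(ltW rho0)//.
  move: ht; set s := (tau k - x0) / h - k%:R => ht.
  have -> : x - tau k = h * ((t - k%:R) - s).
    by rewrite /t /s; field; rewrite gt_eqF.
  rewrite normrM gtr0_norm// (_ : rho = h * m); last by rewrite /h divfK ?gt_eqF.
  rewrite ler_pM2l// ler_norml; move: (t - k%:R) s ht hk => a b /andP[b0 bm] /andP[aa0 am].
  by apply/andP; split; lra.
- move=> k; rewrite negb_and -!leNgt => /orP[tk|tk].
    by rewrite bspline_le0 ?mulr0.
  by rewrite bspline_ge ?mulr0.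
- have -> : m * (c * (del / (D + 1)) * K) = D / (D + 1) * del.
    transitivity (m * (c * K) * (del / (D + 1))); first by ring.
    by rewrite -/D mulrA mulrAC.
  by rewrite ler_piMl ?(ltW del0)// ler_pdivrMr// mul1r lerDl.
Qed.

End Density.

(** * From the uniform norm to the weighted L^p norms *)

Section LpNorm.
Variable R : realType.
Notation mu := (@lebesgue_measure R).

Lemma fin_union_compact (Om : set R) : fin_union_closed_intervals Om -> compact Om.
Proof.
move=> [s ->]; elim: s => [|[a b] s IH].
  rewrite (_ : [set x | _] = set0); first exact: compact0.
  by apply/seteqP; split.
rewrite (_ : [set x | _] = `[a, b] `|` [set x | has (fun ab : R * R => ab.1 <= x <= ab.2) s]).
  by apply: compactU => //; exact: segment_compact.
apply/seteqP; split => x /=; rewrite in_itv/=.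
  by case/orP => [|h]; [left|right].
by case=> [->//|->]; rewrite orbT.
Qed.

Lemma compact_le (A : set R) (f : R -> R) : compact A -> {within A, continuous f} ->
  exists2 M, 0 < M & forall x, A x -> `|f x| <= M.
Proof.
move=> cA cf; have [M [_ hM]] := compact_bounded (continuous_compact cf cA).
exists (`|M| + 1) => [|x Ax]; first by rewrite ltr_pwDr.
by apply: (hM (`|M| + 1)); [rewrite (le_lt_trans (ler_norm _))// ltrDl|exists x].
Qed.

Lemma holder_continuous (A : set R) (g : R -> R) (al c : R) : 0 < al ->
  (forall x y, A x -> A y -> `|g x - g y| <= c * powR `|x - y| al) ->
  {within A, continuous g}.
Proof.
move=> al0 hg; apply/subspace_continuousP => x Ax.
apply/cvgrPdist_le => e e0.
have c1 : 0 < `|c| + 1 by rewrite ltr_pwDr.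
have ec : 0 < e / (`|c| + 1) by rewrite divr_gt0.
pose d := powR (e / (`|c| + 1)) al^-1.
have d0 : 0 < d by rewrite powR_gt0.
have dal : powR d al = e / (`|c| + 1) by rewrite -powRrM mulVf ?gt_eqF// powRr1// ltW.
near=> y.
have Ay : A y by near: y; exact: withinT.
have xy : `|x - y| < d.
  by near: y; apply: cvg_within; exact: nbhsx_ballx.
rewrite (le_trans (hg _ _ Ax Ay))//.
apply: (@le_trans _ _ (`|c| * powR `|x - y| al)).
  by rewrite ler_wpM2r ?powR_ge0// ler_norm.
apply: (@le_trans _ _ (`|c| * powR d al)).
  by rewrite ler_wpM2l// ge0_ler_powR ?nnegrE ?(ltW al0) ?(ltW d0)// ltW.
by rewrite dal mulrCA ler_piMr ?(ltW e0)// ler_pdivrMr// mul1r lerDl.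
Unshelve. all: by end_near. Qed.

Lemma Lp_w_norm_small (Om : set R) (w : R -> R) (p : \bar R) (eps : R) :
  compact Om -> {within Om, continuous w} -> (forall x, Om x -> 0 < w x) ->
  (1 <= p)%E -> 0 < eps ->
  exists2 del : R, 0 < del & forall f : R -> Cplx R,
    {within Om, continuous (fun x => cabs (f x))} ->
    (forall x, Om x -> cabs (f x) <= del) -> (Lp_w_norm Om w p f < eps%:E)%E.
Proof.
move=> cO cw w0 p1 eps0.
have [W W0 wW] := compact_le cO cw.
have [M M0 OM] := compact_le cO (continuous_subspaceT (fun x => cvg_id)).
have mO : measurable Om by exact: compact_measurable.
have muO : (mu Om <= (2 * M)%:E)%E.
  apply: (@le_trans _ _ (mu `[- M, M])).
    apply: le_measure; rewrite ?inE// => x /OM.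
    by rewrite /= in_itv/= ler_norml.
  rewrite lebesgue_measure_itv/= lte_fin gtrN// -EFinB lee_fin; lra.
(* [K] dominates both the weighted measure of [Om] and the bound [W] of the weight, and [K >= 1]
   gives [K^(1/p) <= K] for finite [p]. *)
pose K := W * (2 * M + 1) + 1.
have K0 : 0 < K by rewrite addr_gt0// mulr_gt0// addr_gt0// mulr_gt0.
have K1 : 1 <= K by rewrite lerDr mulr_ge0 ?(ltW W0)// addr_ge0// mulr_ge0// ltW.
pose del := eps / (2 * K).
have del0 : 0 < del by rewrite divr_gt0// mulr_gt0.
have Kdel : K * del = eps / 2 by rewrite /del; field; rewrite gt_eqF.
exists del => // f cf fdel.
case: p p1 => [p'|//|//]; rewrite ?leeNy_eq//= ?lee_fin => p1.
- have p0 : 0 < p' by exact: lt_le_trans p1.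
  have mf : measurable_fun Om (fun x => w x * powR (cabs (f x)) p').
    apply: measurable_funM; first exact: subspace_continuous_measurable_fun.
    apply: (measurableT_comp (measurable_powR p')).
    exact: subspace_continuous_measurable_fun.
  have le1 : (\int[mu]_(x in Om) (w x * powR (cabs (f x)) p')%:E <= (K * powR del p')%:E)%E.
    apply: (@le_trans _ _ (\int[mu]_(x in Om) (W * powR del p')%:E)%E).
      apply: ge0_le_integral => //.
      - by move=> x Ox; rewrite lee_fin mulr_ge0 ?powR_ge0// ltW// w0.
      - exact/measurable_EFinP.
      - move=> x Ox; rewrite lee_fin ler_pM ?powR_ge0//.
        + by rewrite ltW// w0.
        + by rewrite (le_trans (ler_norm _))// wW.
        + by rewrite ge0_ler_powR ?nnegrE ?cabs_ge0 ?(ltW p0) ?(ltW del0)// fdel.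
    rewrite integral_cst//= (le_trans (lee_wpmul2l _ muO))//.
      by rewrite lee_fin mulr_ge0 ?powR_ge0// ltW.
    rewrite -EFinM lee_fin mulrAC ler_wpM2r ?powR_ge0//.
    by rewrite /K; nra.
  have ge0 : (0 <= \int[mu]_(x in Om) (w x * powR (cabs (f x)) p')%:E)%E.
    by apply: integral_ge0 => x Ox; rewrite lee_fin mulr_ge0 ?powR_ge0// ltW// w0.
  apply: (@le_lt_trans _ _ (poweR (K * powR del p')%:E p'^-1)).
    by apply: gt0_ler_poweR; rewrite ?in_itv/= ?leey ?andbT ?lee_fin ?invr_ge0 ?(ltW p0) ?mulr_ge0 ?powR_ge0 ?(ltW K0).
  rewrite poweR_EFin lte_fin powRM ?powR_ge0 ?(ltW K0)// -powRrM divff ?gt_eqF// powRr1 ?(ltW del0)//.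
  apply: (@le_lt_trans _ _ (K * del)); last by rewrite Kdel; lra.
  rewrite ler_wpM2r ?(ltW del0)// -[leRHS]powRr1 ?(ltW K0)// ler_powR//.
  by rewrite invf_le1.
- apply: (@le_lt_trans _ _ (W * del)%:E).
    apply: ereal_inf_lbound; apply: aeW => x Ox.
    rewrite lee_fin ler_pM ?cabs_ge0 ?fdel//; first by rewrite ltW// w0.
    by rewrite (le_trans (ler_norm _))// wW.
  rewrite lte_fin (@le_lt_trans _ _ (K * del))//; last by rewrite Kdel; lra.
  by rewrite ler_wpM2r ?(ltW del0)// /K; nra.
Qed.

End LpNorm.

(** * Combination of both approximations *)

Section Main.
Variable R : realType.
Local Open Scope complex_scope.

Lemma holder_on_pos (Om : set R) al (q : R -> Cplx R) : holder_on Om al q ->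
  exists2 c, 0 <= c & forall x y, Om x -> Om y -> cabs (q x - q y) <= c * powR `|x - y| al.
Proof.
move=> [c hc]; exists `|c| => // x y Ox Oy.
by rewrite (le_trans (hc _ _ Ox Oy))// ler_wpM2r ?powR_ge0// ler_norm.
Qed.

Lemma W_m_uniformly_dense (Om : set R) (al M : R) (n : nat) (q : R -> Cplx R) (del : R) :
  0 < al < 1 -> (0 < n)%N -> 0 < M -> (forall x, Om x -> `|x| <= M) ->
  holder_on Om al q -> 0 < del ->
  exists2 g : R -> Cplx R, W_m Om al n.+1 g & forall x, Om x -> cabs (q x - g x) <= del.
Proof.
move=> al01 n0 M0 OM hq del0.
have del2 : 0 < del / 2 by rewrite divr_gt0.
have [c c0 hc] := holder_on_pos hq.
have [x0 [h [N [a [h0 ha]]]]] :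
    exists (x0 h : R) (N : nat) (a : nat -> R), 0 < h /\ forall x, Om x ->
    n%:R <= (x - x0) / h <= N%:R /\ `|complex.Im (q x) - pi * spline n x0 h N a x| <= del / 2.
  apply: (spline_dense n0 al01 (ltW M0) c0 del2 OM) => x y Ox Oy.
  by rewrite -ImN -ImD (le_trans (Im_le_cabs _))// hc.
pose T (x : R) := (x - x0) / h.
pose A := [set T x | x in Om].
have [hga _] := @W_m_spline_cauchy R n n0 x0 h N a h0 Om al M al01 OM.
have [c' c'0 hc'] := holder_on_pos hga.
(* The real error left by the first approximant, a difference of Hölder functions. *)
pose u (x : R) := complex.Re (q x) - complex.Re (spline_cauchy n x0 h N a x%:C).
have hu x y : Om x -> Om y -> `|u x - u y| <= (c + c') * powR `|x - y| al.
  move=> Ox Oy; rewrite mulrDl.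
  have -> : u x - u y = complex.Re (q x - q y) -
     complex.Re (spline_cauchy n x0 h N a x%:C - spline_cauchy n x0 h N a y%:C).
    by rewrite /u !ReD !ReN; ring.
  rewrite (le_trans (ler_normB _ _))// lerD//.
    by rewrite (le_trans (Re_le_cabs _))// hc.
  by rewrite (le_trans (Re_le_cabs _))// hc'.
pose T' (t : R) := h * t + x0.
have TK x : T' (T x) = x by rewrite /T' /T; field; rewrite gt_eqF.
(* One unit of slack keeps the length positive even if [N = 0]. *)
have L0 : 0 < N%:R + 1 :> R by rewrite ltr_wpDl.
have AL t : A t -> 0 <= t <= N%:R + 1.
  move=> [x Ox <-]; have [/andP[h1 h2] _] := ha x Ox; rewrite /T.
  by rewrite (le_trans _ h1)//= (le_trans h2)// lerDl.
have modu : forall e, 0 < e -> exists2 K, 0 <= K & forall s t, A s -> A t ->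
     `|u (T' s) - u (T' t)| <= e + K * (s - t) ^+ 2.
  apply: (holder_modulus (al := al) (c := (c + c') * powR h al)) => //.
    by rewrite mulr_ge0 ?powR_ge0// addr_ge0.
  move=> _ _ [x Ox <-] [y Oy <-]; rewrite !TK (le_trans (hu _ _ Ox Oy))//.
  rewrite -mulrA -powRM ?(ltW h0)//.
  suff -> : h * `|T x - T y| = `|x - y| by [].
  rewrite -[X in X * _](gtr0_norm h0) -normrM; congr (`|_|).
  by rewrite /T; field; rewrite gt_eqF.
(* On [Om] the grid variable is at most [N], so translates of index at least [N.+1] vanish there and
   alter only the real part. *)
have [N' [d [d0 hd]]] := shifted_cauchy_dense n0 N.+1 L0 AL modu del2.
(* Extending by zero lets both coefficient families share the index range below [N2]. *)
pose b k := if (k < N)%N then a k else 0.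
pose e k := b k + d k.
pose N2 := maxn N N'.
have sumE (f : nat -> R) : \sum_(k < N2) e k * f k =
    \sum_(k < N) a k * f k + \sum_(k < N') d k * f k.
  rewrite -(@sum_pad _ N' N2 d) ?leq_maxr//; last by move=> k hk; rewrite d0// hk orbT.
  have -> : \sum_(k < N) a k * f k = \sum_(k < N) b k * f k.
    by apply: eq_bigr => k _; rewrite /b ltn_ord.
  rewrite -(@sum_pad _ N N2 b) ?leq_maxl//; last first.
    by move=> k hk; rewrite /b ltnNge hk.
  by rewrite -big_split; apply: eq_bigr => k _; rewrite mulrDl.
exists (fun x => spline_cauchy n x0 h N2 e (realC x)).
  exact: W_m_spline_cauchy OM.
move=> x Ox; have [/andP[nx xN] him] := ha x Ox.
have Ax : A (T x) by exists x.
rewrite (le_trans (cabs_le _))// [leRHS]splitr !(ReD, ImD) !(ReN, ImN) lerD//.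
  rewrite Re_spline_cauchy (sumE (fun k => complex.Re (bspline_cauchy n ((x - x0) / h - k%:R)%:C))).
  have := hd _ Ax; rewrite TK /u Re_spline_cauchy /shifted_cauchy /T.
  by rewrite -addrA -opprD.
rewrite spline_cauchy_real// /spline (sumE (fun k => cardinal_bspline n.+1 ((x - x0) / h - k%:R))).
have -> : \sum_(k < N') d k * cardinal_bspline n.+1 ((x - x0) / h - k%:R) = 0.
  apply: big1 => k _; have [kN|Nk] := leqP k N.
    by rewrite d0 ?mul0r// ltnS kN.
  by rewrite bspline_le0 ?mulr0// subr_le0 (le_trans xN)// ler_nat ltnW.
by rewrite addr0.
Qed.

End Main.

Unset Implicit Arguments.

Theorem theorem4p1 (R : realType) (Om : set R) (w : R -> R) (al : R)
    (p : \bar R) (m : nat) :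
  fin_union_closed_intervals Om ->
  {within Om, continuous w} ->
  (forall x, Om x -> 0 < w x) ->
  0 < al < 1 ->
  (1 <= p)%E ->
  (2 <= m)%N ->
  forall q : R -> Cplx R, W_alpha Om al q ->
  forall eps : R, 0 < eps ->
  exists g : R -> Cplx R, W_m Om al m g /\
    (Lp_w_norm Om w p (fun x => (q x - g x)%R) < eps%:E)%E.
Proof.
move=> hO cw w0 al01 p1 m2 q [hq _] eps eps0.
have cO := fin_union_compact hO.
have [M M0 OM] := compact_le cO (continuous_subspaceT (fun x : R => cvg_id)).
have [del del0 hdel] := Lp_w_norm_small cO cw w0 p1 eps0.
case: m m2 => [//|n]; rewrite ltnS => n0.
have [g Wg qg] := W_m_uniformly_dense al01 n0 M0 OM hq del0.
exists g; split => //; apply: hdel => //.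
(* The norm estimate needs [|q - g|] continuous on [Om]; the reverse triangle inequality passes on
   the Hölder bounds of [q] and [g]. *)
have [c c0 hc] := holder_on_pos hq; have [c' c'0 hc'] := holder_on_pos Wg.1.
have /andP[al0 _] := al01.
apply: (holder_continuous (al := al) (c := c + c')) => // x y Ox Oy.
apply: (@le_trans _ _ (cabs ((q x - g x) - (q y - g y)))).
  have tri (z u : Cplx R) : cabs z - cabs u <= cabs (z - u).
    by rewrite lerBlDr -[X in cabs X <= _](subrK u) cabsD.
  by rewrite ler_norml; have := tri (q x - g x) (q y - g y);
    have := tri (q y - g y) (q x - g x); rewrite [X in _ <= X -> _]cabsC => *; apply/andP; split; lra.
have -> : q x - g x - (q y - g y) = (q x - q y) - (g x - g y) by ring.
rewrite (le_trans (cabsD _ _))// cabsN mulrDl lerD//; [exact: hc|exact: hc'].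
Qed.
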